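(* Let $0<\lambda<1$ and $\zeta_\lambda(z)=\lambda\frac{z}{z+1}e^{-z}$, $z\in\mathbb{C}$. Let $A(0)=\{z\in\hat{\mathbb{C}}:\zeta_\lambda^{n}(z)\to 0 \text{ as } n\to\infty\}$ be the basin of attraction of the attracting fixed point $0$. Then the Julia set satisfies $J(\zeta_\lambda)=\hat{\mathbb{C}}\setminus A(0)$.
   Context: $\hat{\mathbb{C}}$ is the extended complex plane. For the transcendental meromorphic function $\zeta_\lambda$, the Fatou set $F(\zeta_\lambda)$ is the set of points of $\hat{\mathbb{C}}$ having a neighbourhood on which all iterates $\zeta_\lambda^{n}$ are defined and form a normal family; the Julia set $J(\zeta_\lambda)$ is its complement $\hat{\mathbb{C}}\setminus F(\zeta_\lambda)$. *)

(* Defs.v *)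
From Stdlib Require Import Reals.
From Coquelicot Require Import Coquelicot.
Open Scope R_scope.

Definition Cexp (z : C) : C :=
  (exp (fst z) * cos (snd z), exp (fst z) * sin (snd z)).

(* Extended complex plane: None is the point at infinity. *)
Definition Chat := option C.

Definition chord (a b : Chat) : R :=
  match a, b with
  | Some z, Some w =>
      2 * Cmod (Cminus z w) / sqrt ((1 + Cmod z ^ 2) * (1 + Cmod w ^ 2))
  | Some z, None | None, Some z => 2 / sqrt (1 + Cmod z ^ 2)
  | None, None => 0
  end.

(* One application of zeta_lambda(z) = lambda * z/(z+1) * e^{-z} as a
   partial map of the sphere: undefined (None) at infinity (essential
   singularity), infinity at the pole z = -1. *)
Definition zeta_step (lam : R) (w : Chat) : option Chat :=
  match w with
  | None => None
  | Some z =>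
      if Req_EM_T (Cmod (Cplus z (RtoC 1))) 0 then Some None
      else Some (Some (Cmult (Cmult (RtoC lam) (Cdiv z (Cplus z (RtoC 1))))
                             (Cexp (Copp z))))
  end.

(* n-th iterate; None means "not defined". *)
Fixpoint zeta_iter (lam : R) (n : nat) (w : Chat) : option Chat :=
  match n with
  | O => Some w
  | S m => match zeta_iter lam m w with
           | Some v => zeta_step lam v
           | None => None
           end
  end.

(* Value of the n-th iterate (default irrelevant where defined). *)
Definition zeta_iter_val (lam : R) (n : nat) (w : Chat) : Chat :=
  match zeta_iter lam n w with Some v => v | None => None end.

Definition chord_ball (w : Chat) (r : R) (v : Chat) : Prop := chord w v < r.

Definition iterates_defined_on (lam : R) (U : Chat -> Prop) : Prop :=
  forall n v, U v -> zeta_iter lam n v <> None.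

Definition loc_unif_cvg (F : nat -> Chat -> Chat) (g : Chat -> Chat)
  (U : Chat -> Prop) : Prop :=
  forall w, U w -> exists r, 0 < r /\ (forall v, chord w v < r -> U v) /\
    forall eps, 0 < eps -> exists N, forall k, (N <= k)%nat ->
      forall v, chord w v < r -> chord (F k v) (g v) < eps.

Definition iterates_normal_on (lam : R) (U : Chat -> Prop) : Prop :=
  forall m : nat -> nat, exists (phi : nat -> nat) (g : Chat -> Chat),
    (forall k, (phi k < phi (S k))%nat) /\
    loc_unif_cvg (fun k => zeta_iter_val lam (m (phi k))) g U.

Definition Fatou (lam : R) (w : Chat) : Prop :=
  exists r, 0 < r /\ iterates_defined_on lam (chord_ball w r) /\
            iterates_normal_on lam (chord_ball w r).

Definition Julia (lam : R) (w : Chat) : Prop := ~ Fatou lam w.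

Definition basin0 (lam : R) (w : Chat) : Prop :=
  (forall n, zeta_iter lam n w <> None) /\
  forall eps, 0 < eps -> exists N, forall n, (N <= n)%nat ->
    chord (zeta_iter_val lam n w) (Some (RtoC 0)) < eps.

(* Main.v *)
Require Import Defs.
From Stdlib Require Import Reals Lra Lia Psatz Wf_nat Classical ClassicalEpsilon.
From Coquelicot Require Import Coquelicot.
Open Scope R_scope.

(** Write [f] for zeta_lambda. The half-strip [Re z >= 0, |Im z| <= 1.56] is mapped into
    itself with [|f z| <= lam |z|], so it lies in the basin of [0]. In the metric [|dz|/|z|]
    the map [f] stretches by [|q z|], where [q z = z f'(z) / f(z) = 1/(z+1) - z]. Outside the
    half-strip and a disc around [0], [|q| <= 1] happens only near the critical point
    [-(1 + sqrt 5)/2], and those points are mapped into the half-strip. Hence [f] is uniformly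
    expanding along every orbit outside the basin.

    This makes the basin dense in every open set where all iterates are defined. Otherwise
    maximise [cot (arg (f^n z) / 2) - L |z - z0|^2] over a square without basin points: the
    cotangent is bounded there, so for a suitable [L] the maximum is interior, while turning
    [f^n z] about [0] costs only a displacement of [z] of order [kappa^-n]
    ([kappa > 1] the expansion factor), which for large [n]
    contradicts maximality. Finally, on a neighbourhood where the iterates are normal, a limit
    function vanishes on the dense set of basin points, so some iterate of the centre is small
    and the centre itself belongs to the basin. *)

(** * Image of a neighbourhood of the left critical point *)

(** [exp (- u)] times the cubic Taylor polynomial has derivative [- exp (- u) * u ^ 3 / 6], so it is
    largest at [u = 0], where it equals [1]. Negative [s] is covered too, which yields upper bounds
    for [exp]. *)
Lemma exp_ge_cubic (s : R) : 1 + s + s ^ 2 / 2 + s ^ 3 / 6 <= exp s.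
Proof.
  pose (g := fun u => exp (- u) * (1 + u + u ^ 2 / 2 + u ^ 3 / 6)).
  assert (Hd : forall u, is_derive g u (- exp (- u) * (u ^ 3 / 6))).
  { intros u. unfold g. auto_derive; [easy | ]. field. }
  assert (Hc : forall u, continuity_pt g u).
  { intros u. apply continuity_pt_filterlim, @ex_derive_continuous.
    eexists; apply Hd. }
  destruct (MVT_gen g 0 s (fun u => - exp (- u) * (u ^ 3 / 6))) as [c [Hcb Hcv]];
    [intros; apply Hd | intros; apply Hc | ].
  assert (Hle : g s <= 1).
  { assert (E0 : g 0 = 1) by (unfold g; rewrite Ropp_0, exp_0; lra).
    rewrite E0 in Hcv.
    assert (He := exp_pos (- c)).
    assert (0 <= c ^ 3 * s).
    { destruct (Rle_dec 0 s).
      - rewrite Rmin_left, Rmax_right in Hcb by lra.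
        apply Rmult_le_pos; [apply pow_le; lra | lra].
      - rewrite Rmin_right, Rmax_left in Hcb by lra.
        assert (0 <= c ^ 2) by apply pow2_ge_0.
        replace (c ^ 3 * s) with (c ^ 2 * (c * s)) by ring. apply Rmult_le_pos; nra. }
    nra. }
  unfold g in Hle.
  assert (Hs := exp_pos s).
  assert (E : exp s * exp (- s) = 1) by (rewrite <- exp_plus, Rplus_opp_r; apply exp_0).
  apply Rmult_le_compat_l with (r := exp s) in Hle; [ | lra].
  rewrite <- Rmult_assoc, E in Hle. lra.
Qed.

(** The cubic lower bound [p] for [exp (- t)] times the quadratic is at least [1]. The interval is
    the range of [a - 87/100] in [exp_le_majorant]. *)
Lemma exp_le_quadratic (t : R) : -46/100 <= t <= 14/100 ->
  exp t <= 1 + t + 55/100 * t ^ 2.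
Proof.
  intros Ht.
  assert (H := exp_ge_cubic (- t)).
  assert (Hp := exp_pos t).
  assert (E : exp t * exp (- t) = 1) by (rewrite <- exp_plus, Rplus_opp_r; apply exp_0).
  set (p := 1 + - t + (- t) ^ 2 / 2 + (- t) ^ 3 / 6) in H.
  assert (0 < p) by (unfold p; nra).
  assert (1 <= (1 + t + 55/100 * t ^ 2) * p).
  { replace ((1 + t + 55/100 * t ^ 2) * p) with
      (1 + t ^ 2 * (5/100 + t * (-13/60 + t * (13/120 - t * 11/120)))) by (unfold p; field).
    assert (0 <= t ^ 2) by nra.
    assert (0 <= 5/100 + t * (-13/60 + t * (13/120 - t * 11/120))) by nra.
    nra. }
  assert (exp t * p <= 1) by nra.
  nra.
Qed.

(** The cubic bound is accurate only near [0], so it is applied at [- 187/800] and the result raised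
    to the eighth power. *)
Lemma exp_187_le : exp (187/100) <= 65/10.
Proof.
  assert (H := exp_ge_cubic (- (187/800))).
  assert (H2 : exp (187/800) * exp (- (187/800)) = 1)
    by (rewrite <- exp_plus, Rplus_opp_r; apply exp_0).
  assert (Hp := exp_pos (187/800)).
  assert (Hu : exp (187/800) <= 12636/10000) by nra.
  replace (exp (187/100)) with (exp (187/800) ^ 8);
    [ | simpl; rewrite Rmult_1_r, <- !exp_plus; f_equal; lra].
  eapply Rle_trans; [apply pow_incr; split; [lra | exact Hu] | lra].
Qed.

Lemma exp_le_majorant (a : R) : 41/100 <= a <= 101/100 ->
  exp (1 + a) <= 65/10 * (1 + (a - 87/100) + 55/100 * (a - 87/100) ^ 2).
Proof.
  intros Ha.
  replace (1 + a) with (187/100 + (a - 87/100)) by lra.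
  rewrite exp_plus.
  assert (H1 := exp_187_le).
  assert (H2 := exp_le_quadratic (a - 87/100) ltac:(lra)).
  apply Rmult_le_compat; try lra; left; apply exp_pos.
Qed.

(* [|z^2 + z - 1|^2 - |z + 1|^2], i.e. [(|q|^2 - 1) |z + 1|^2] with [q z = 1/(z+1) - z]. *)
Definition expansion_gap (x y : R) : R :=
  x * (x + 2) * (x ^ 2 - 2) + y ^ 4 + y ^ 2 * (2 * x ^ 2 + 2 * x + 2).

(* Near the critical point write [z = - 1 - a + i b] and [B = b^2]; the hypothesis below is
   [expansion_gap <= |z + 1|^2 / 1000]. The affine bounds used later are tangents to the
   resulting bound on [B] as a function of [a]. *)
Lemma sq_le_affine (a B k m : R) : 0 <= B -> 0 <= a ->
  B ^ 2 + 2 * B * (a ^ 2 + a + 1) <=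
    (1 - a ^ 2) * (a ^ 2 + 2 * a - 1) + 1/1000 * (a ^ 2 + B) ->
  (1 - a ^ 2) * (a ^ 2 + 2 * a - 1) + 1/1000 * a ^ 2
    <= (k + m * a) * (2 * (a ^ 2 + a + 1) - 1/1000) -> B <= k + m * a.
Proof.
  intros HB Ha HD H.
  assert (0 < 2 * (a ^ 2 + a + 1) - 1/1000) by nra.
  assert (0 <= B ^ 2) by apply pow2_ge_0.
  apply Rmult_le_reg_r with (2 * (a ^ 2 + a + 1) - 1/1000); lra.
Qed.

(** After the shift [a = m + t] to the point of tangency, [lra] finds the inequality as a linear
    combination of these nonnegative products, with the powers of [t] as atoms. *)
Ltac tangent_at a m :=
  let t := fresh "t" in
  pose (t := a - m); replace a with (m + t) in * by (unfold t; ring); clearbody t;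
  assert (0 <= t ^ 2) by apply pow2_ge_0;
  assert (0 <= t ^ 2 * (1/2 + t)) by (apply Rmult_le_pos; lra);
  assert (0 <= (t ^ 2) ^ 2) by apply pow2_ge_0;
  lra.

Ltac near_point a m :=
  let t := fresh "t" in
  pose (t := a - m); replace a with (m + t) in * by (unfold t; ring); clearbody t;
  assert (0 <= t ^ 2) by apply pow2_ge_0;
  assert (0 <= t ^ 2 * (1/10 + t)) by (apply Rmult_le_pos; lra);
  assert (0 <= t ^ 2 * (1/10 - t)) by (apply Rmult_le_pos; lra);
  assert (0 <= t ^ 4) by (replace (t ^ 4) with ((t ^ 2) ^ 2) by ring; apply pow2_ge_0);
  assert (0 <= t ^ 4 * (1/10 + t)) by (apply Rmult_le_pos; lra);
  assert (0 <= t ^ 4 * (1/10 - t)) by (apply Rmult_le_pos; lra);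
  assert (0 <= t ^ 6) by (replace (t ^ 6) with ((t ^ 3) ^ 2) by ring; apply pow2_ge_0);
  assert (t ^ 2 <= 1/100) by nra;
  assert (0 <= (1/100 - t ^ 2) * t ^ 2) by (apply Rmult_le_pos; lra);
  assert (0 <= (1/100 - t ^ 2) * t ^ 4) by (apply Rmult_le_pos; lra);
  lra.

Definition exp_majorant (a : R) := 65/10 * (1 + (a - 87/100) + 55/100 * (a - 87/100) ^ 2).

(* Majorant of [Im - 156/100] for [e^(1+a) (1 + 1/(a + i b)) e^(i b)], up to the factor
   [a^2 + B]; [b] has been replaced by [(B + 0.27^2) / 0.54], which avoids the square root of
   [B], and [sin b], [cos b] by Taylor polynomials. *)
Definition im_excess (a B : R) := exp_majorant a *
   ((B + 729/10000) / (54/100)) *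
   (a ^ 2 + a - 1 + B * (15/10 - (a ^ 2 + a) * 16/100)) - 156/100 * (a ^ 2 + B).

(** The increment of [im_excess] from [B] to [L] is [L - B] times [exp_majorant a * (P + 729/10000 *
    M + M * (B + L)) / (54/100) - 156/100], which is positive because [85/54 > 156/100]. *)
Lemma im_excess_mono (a B k m : R) : 70/100 <= a <= 101/100 ->
  0 <= B -> B <= k + m * a -> im_excess a (k + m * a) <= 0 -> im_excess a B <= 0.
Proof.
  intros Ha HB HL H.
  unfold im_excess in *.
  set (L := k + m * a) in *.
  set (P := a ^ 2 + a - 1) in *.
  set (M := 15/10 - (a ^ 2 + a) * 16/100) in *.
  assert (HE : 52/10 <= exp_majorant a) by (unfold exp_majorant; nra).
  assert (HP : 19/100 <= P) by (unfold P; nra).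
  assert (HM : 117/100 <= M) by (unfold M; nra).
  assert (Hdd : 85/100 <= exp_majorant a * (P + 729/10000 * M + M * (B + L))).
  { assert (0 <= M * (B + L)) by (apply Rmult_le_pos; lra).
    assert (27/100 <= P + 729/10000 * M + M * (B + L)) by lra.
    apply Rle_trans with (52/10*(27/100)); [ lra | apply Rmult_le_compat; lra]. }
  assert (0 <= (L - B) * (exp_majorant a * (P + 729/10000 * M + M * (B + L)) / (54/100) - 156/100))
    by (apply Rmult_le_pos; lra).
  set (e := exp_majorant a) in *. clearbody e. lra.
Qed.

(** On each of four intervals [B] is replaced by a tangent line to its bound; monotonicity in [B]
    leaves a polynomial inequality in [a] alone. *)
Lemma im_excess_le_0 (a B : R) : 70/100 <= a <= 101/100 -> 0 <= B ->
  B ^ 2 + 2 * B * (a ^ 2 + a + 1) <=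
    (1 - a ^ 2) * (a ^ 2 + 2 * a - 1) + 1/1000 * (a ^ 2 + B) ->
  im_excess a B <= 0.
Proof.
  intros Ha HB HD.
  destruct (Rle_dec a (80/100)); [ | destruct (Rle_dec a (88/100));
   [ | destruct (Rle_dec a (95/100))]].
  - apply (im_excess_mono a B (1928/10000) (-1220/10000)); try easy;
    [apply sq_le_affine; try easy; [lra | tangent_at a (75/100)]
    | unfold im_excess, exp_majorant; near_point a (75/100)].
  - apply (im_excess_mono a B (3571/10000) (-3287/10000)); try easy;
    [apply sq_le_affine; try easy; [lra | tangent_at a (84/100)]
    | unfold im_excess, exp_majorant; near_point a (84/100)].
  - apply (im_excess_mono a B (5000/10000) (-4916/10000)); try easy;
    [apply sq_le_affine; try easy; [lra | tangent_at a (915/1000)]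
    | unfold im_excess, exp_majorant; near_point a (915/1000)].
  - apply (im_excess_mono a B (6274/10000) (-6263/10000)); try easy;
    [apply sq_le_affine; try easy; [lra | tangent_at a (98/100)]
    | unfold im_excess, exp_majorant; near_point a (98/100)].
Qed.

Lemma sq_le_1043 (a B : R) : 41/100 <= a <= 101/100 -> 0 <= B ->
  B ^ 2 + 2 * B * (a ^ 2 + a + 1) <=
    (1 - a ^ 2) * (a ^ 2 + 2 * a - 1) + 1/1000 * (a ^ 2 + B) ->
  B <= 1043/10000.
Proof.
  intros Ha HB HD.
  (* The bound on [B] peaks close to [a = 6988/10000], so the line used is horizontal. *)
  replace (1043/10000) with (1043/10000 + 0 * a) by ring.
  apply sq_le_affine; try easy; [lra | tangent_at a (6988/10000)].
Qed.

Lemma sin_le_quintic (b : R) : 0 <= b <= 4 -> sin b <= b * (1 - b ^ 2 / 6 + b ^ 4 / 120).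
Proof.
  intros Hb. destruct (pre_sin_bound b 0) as [_ H]; try lra.
  unfold sin_approx, sin_term in H; simpl in H. lra.
Qed.

Lemma sin_ge_cubic (b : R) : 0 <= b <= 4 -> b * (1 - b ^ 2 / 6) <= sin b.
Proof.
  intros Hb. destruct (pre_sin_bound b 0) as [H _]; try lra.
  unfold sin_approx, sin_term in H; simpl in H. lra.
Qed.

Lemma cos_ge_quadratic (b : R) : -2 <= b <= 2 -> 1 - b ^ 2 / 2 <= cos b.
Proof.
  intros Hb. destruct (pre_cos_bound b 0) as [H _]; try lra.
  unfold cos_approx, cos_term in H; simpl in H. lra.
Qed.

Lemma cos_ge_0_156 (y : R) : Rabs y <= 156/100 -> 0 <= cos y.
Proof.
  intros Hy. apply Rabs_le_between in Hy.
  destruct (pre_cos_bound y 1) as [H _]; try lra.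
  unfold cos_approx, cos_term in H; simpl in H.
  assert (Hy2 : 0 <= y * y <= 24336/10000) by nra.
  set (s := y * y) in *.
  assert (0 <= 1 - s / 2 + s * s / 24 - s * s * s / 720) by nra.
  unfold s in *; lra.
Qed.

(** Divided by [a^2 + b^2], the left side is [- Im (f z) / lam] at [z = - 1 - a + i b]. Taylor
    bounds reduce it to [exp (1 + a) * b * q], estimated crudely for [a <= 70/100] and through
    [im_excess] beyond. *)
Lemma im_upper_bound (a b : R) : 41/100 <= a <= 101/100 -> 0 <= b ->
  b ^ 4 + 2 * b ^ 2 * (a ^ 2 + a + 1) <=
    (1 - a ^ 2) * (a ^ 2 + 2 * a - 1) + 1/1000 * (a ^ 2 + b ^ 2) ->
  exp (1 + a) * (sin b * (a ^ 2 + a + b ^ 2) - b * cos b) <= 156/100 * (a ^ 2 + b ^ 2).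
Proof.
  intros Ha Hb HD.
  set (B := b ^ 2) in *.
  assert (HB : 0 <= B) by apply pow2_ge_0.
  replace (b ^ 4) with (B ^ 2) in HD by (unfold B; ring).
  assert (HB1 := sq_le_1043 a B Ha HB HD).
  assert (Hb1 : b <= 323/1000) by (unfold B in *; nra).
  assert (He := exp_le_majorant a Ha). fold (exp_majorant a) in He.
  assert (Hep := exp_pos (1 + a)).
  assert (Hs := sin_le_quintic b ltac:(lra)).
  assert (Hc := cos_ge_quadratic b ltac:(lra)).
  fold B in Hs, Hc. replace (b ^ 4) with (B ^ 2) in Hs by (unfold B; ring).
  assert (Hs2 : sin b <= b * (1 - 16/100 * B)).
  { eapply Rle_trans; [exact Hs | apply Rmult_le_compat_l; nra]. }
  assert (HS : 0 <= a ^ 2 + a + B) by nra.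
  (* [(1 - 16/100 * B) * (a^2 + a + B) - (1 - B / 2)] without its term [- 16/100 * B^2]. *)
  set (q := a ^ 2 + a - 1 + B * (15/10 - (a ^ 2 + a) * 16/100)).
  assert (Hq : sin b * (a ^ 2 + a + B) - b * cos b <= b * q).
  { assert (sin b * (a ^ 2 + a + B) <= b * (1 - 16/100 * B) * (a ^ 2 + a + B))
      by (apply Rmult_le_compat_r; lra).
    assert (b * (1 - B / 2) <= b * cos b) by (apply Rmult_le_compat_l; lra).
    assert (b * (1 - 16/100 * B) * (a ^ 2 + a + B) - b * (1 - B / 2)
      = b * q - 16/100 * (b * B ^ 2)) by (unfold q; field).
    assert (0 <= b * B ^ 2) by (apply Rmult_le_pos; [lra | apply pow2_ge_0]).
    lra. }
  apply Rle_trans with (exp (1 + a) * (b * q)); [apply Rmult_le_compat_l; lra | ].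
  destruct (Rle_dec q 0) as [Hq0 | Hq0].
  { apply Rle_trans with 0; [ | nra].
    assert (0 <= exp (1 + a) * b) by (apply Rmult_le_pos; lra). nra. }
  assert (0 <= b * q) by (apply Rmult_le_pos; lra).
  destruct (Rle_dec a (70/100)).
  - apply Rle_trans with (exp_majorant a * (323/1000 * q)).
    { apply Rmult_le_compat; try lra. apply Rmult_le_compat_r; lra. }
    assert (Hq1 : q <= a ^ 2 + a - 1 + 1043/10000 * (15/10)) by (unfold q; nra).
    assert (0 <= exp_majorant a) by (unfold exp_majorant; nra).
    apply Rle_trans with (exp_majorant a * (323/1000 * (a ^ 2 + a - 1 + 1043/10000 * (15/10)))).
    { apply Rmult_le_compat_l; lra. }
    apply Rle_trans with (156/100 * a ^ 2); [ | lra].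
    unfold exp_majorant. nra.
  - assert (HN := im_excess_le_0 a B ltac:(lra) HB HD).
    unfold im_excess in HN. fold q in HN.
    assert (Hbb : b <= (B + 729/10000) / (54/100)).
    { unfold B. assert (0 <= (b - 27/100) ^ 2) by apply pow2_ge_0. lra. }
    apply Rle_trans with (exp_majorant a * ((B + 729/10000) / (54/100)) * q); [ | lra].
    rewrite Rmult_assoc.
    apply Rmult_le_compat; try lra. apply Rmult_le_compat_r; lra.
Qed.

(** For this sign the reduced factor [q = 1 - a - a^2] is positive only for [a < (sqrt 5 - 1) / 2],
    that is, to the right of the critical point. *)
Lemma im_lower_bound (a b : R) : 41/100 <= a <= 101/100 -> 0 <= b ->
  b ^ 4 + 2 * b ^ 2 * (a ^ 2 + a + 1) <=
    (1 - a ^ 2) * (a ^ 2 + 2 * a - 1) + 1/1000 * (a ^ 2 + b ^ 2) ->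
  exp (1 + a) * (b * cos b - sin b * (a ^ 2 + a + b ^ 2)) <= 156/100 * (a ^ 2 + b ^ 2).
Proof.
  intros Ha Hb HD.
  set (B := b ^ 2) in *.
  assert (HB : 0 <= B) by apply pow2_ge_0.
  replace (b ^ 4) with (B ^ 2) in HD by (unfold B; ring).
  assert (HB1 := sq_le_1043 a B Ha HB HD).
  assert (Hb1 : b <= 323/1000) by (unfold B in *; nra).
  assert (He := exp_le_majorant a Ha). fold (exp_majorant a) in He.
  assert (Hep := exp_pos (1 + a)).
  assert (Hs := sin_ge_cubic b ltac:(lra)). fold B in Hs.
  assert (Hc := proj2 (COS_bound b)).
  assert (HS : 0 <= a ^ 2 + a + B) by nra.
  set (q := 1 - a - a ^ 2).
  assert (Hq : b * cos b - sin b * (a ^ 2 + a + B) <= b * q).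
  { assert (b * (1 - B / 6) * (a ^ 2 + a + B) <= sin b * (a ^ 2 + a + B))
      by (apply Rmult_le_compat_r; lra).
    assert (b * cos b <= b * 1) by (apply Rmult_le_compat_l; lra).
    assert (b * (1 - B / 6) * (a ^ 2 + a + B) - b = - b * q + b * B * (1 - (a ^ 2 + a + B) / 6))
      by (unfold q; field).
    assert (0 <= b * B * (1 - (a ^ 2 + a + B) / 6))
      by (apply Rmult_le_pos; [apply Rmult_le_pos; lra | nra]).
    lra. }
  apply Rle_trans with (exp (1 + a) * (b * q)); [apply Rmult_le_compat_l; lra | ].
  destruct (Rle_dec q 0) as [Hq0 | Hq0].
  { apply Rle_trans with 0; [ | nra].
    assert (0 <= exp (1 + a) * b) by (apply Rmult_le_pos; lra). nra. }
  assert (0 <= b * q) by (apply Rmult_le_pos; lra).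
  assert (Ha2 : a <= 62/100) by (apply Rnot_lt_le; intro; apply Hq0; unfold q; nra).
  assert (HBl : B <= -2013/10000 + 511/1000 * a) by (apply sq_le_affine; try easy; [lra | tangent_at a (1/2)]).
  (* A linear bound for the square root of [B], tangent at [B = 4/100]. *)
  assert (Hbb : b <= (B + 4/100) / (40/100)).
  { unfold B. assert (0 <= (b - 2/10) ^ 2) by apply pow2_ge_0. lra. }
  apply Rle_trans with (exp_majorant a * ((B + 4/100) / (40/100) * q)).
  { apply Rmult_le_compat; try lra. apply Rmult_le_compat_r; lra. }
  assert (0 <= exp_majorant a) by (unfold exp_majorant; nra).
  apply Rle_trans with (exp_majorant a * ((-2013/10000 + 511/1000 * a + 4/100) / (40/100) * q)).
  { apply Rmult_le_compat_l; [lra | ]. apply Rmult_le_compat_r; lra. }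
  apply Rle_trans with (156/100 * a ^ 2); [ | lra].
  unfold exp_majorant, q.
  pose (t := a - 1/2). replace a with (1/2 + t) in * by (unfold t; ring). clearbody t.
  assert (0 <= (t + 78/1000) ^ 2) by apply pow2_ge_0.
  assert (0 <= t ^ 2) by apply pow2_ge_0.
  assert (0 <= t ^ 2 * (1/10 + t)) by (apply Rmult_le_pos; lra).
  assert (0 <= t ^ 4) by (replace (t ^ 4) with ((t ^ 2) ^ 2) by ring; apply pow2_ge_0).
  assert (0 <= t ^ 4 * (1/10 + t)) by (apply Rmult_le_pos; lra).
  lra.
Qed.

Lemma near_left_critical_point (x y : R) : x < -12/10 ->
  expansion_gap x y < 1/1000 * ((x + 1) ^ 2 + y ^ 2) ->
  Rabs (exp (- x) * (y * cos y - (x ^ 2 + x + y ^ 2) * sin y))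
    <= 156/100 * ((x + 1) ^ 2 + y ^ 2) /\ Rabs y <= 156/100.
Proof.
  intros Hx HD. unfold expansion_gap in HD.
  set (a := - x - 1). assert (Ea : x = - 1 - a) by (unfold a; ring).
  rewrite Ea in *. clearbody a. clear Ea x.
  assert (Ha : 2/10 < a) by lra. clear Hx.
  replace (- (-1 - a)) with (1 + a) by ring.
  replace ((-1 - a) ^ 2 + (-1 - a)) with (a ^ 2 + a) by ring.
  replace ((-1 - a + 1) ^ 2) with (a ^ 2) in * by ring.
  replace ((-1 - a) * (-1 - a + 2) * ((-1 - a) ^ 2 - 2) + y ^ 4 + y ^ 2 * (2 * (-1 - a) ^ 2 + 2 * (-1 - a) + 2))
   with (y ^ 4 + 2 * y ^ 2 * (a ^ 2 + a + 1) - (1 - a ^ 2) * (a ^ 2 + 2 * a - 1)) in HD by ring.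

  assert (Hy2 : 0 <= y ^ 2) by apply pow2_ge_0.
  assert (Hy4 : 0 <= y ^ 4) by (replace (y ^ 4) with ((y ^ 2) ^ 2) by ring; apply pow2_ge_0).
  assert (HD2 : y ^ 4 + 2 * y ^ 2 * (a ^ 2 + a + 1) <=
    (1 - a ^ 2) * (a ^ 2 + 2 * a - 1) + 1/1000 * (a ^ 2 + y ^ 2)) by lra.
  assert (Hra : 0 < (1 - a ^ 2) * (a ^ 2 + 2 * a - 1) + 1/1000 * a ^ 2) by nra.
  (* For positive [a], [(1 - a^2) * (a^2 + 2 * a - 1)] is positive only between [sqrt 2 - 1] and
     [1]; the term [a^2 / 1000] widens this range at most to [[41/100, 101/100]]. *)
  assert (H41 : 41/100 <= a).
  { apply Rnot_lt_le. intros Ha'.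
    assert (9/1000 <= (1 - a ^ 2) * (1 - 2 * a - a ^ 2)) by
      (apply Rle_trans with (8/10 * (1185/100000)); [lra | apply Rmult_le_compat; nra]).
    nra. }
  assert (H101 : a <= 101/100).
  { apply Rnot_lt_le. intros Ha'.
    assert (2/100 * a ^ 2 <= (a ^ 2 - 1) * (a ^ 2 + 2 * a - 1)) by
      (apply Rmult_le_compat; nra).
    nra. }
  assert (HB := sq_le_1043 a (y ^ 2) (conj H41 H101) Hy2).
  replace ((y ^ 2) ^ 2) with (y ^ 4) in HB by ring.
  specialize (HB HD2).
  split; [ | apply Rabs_le; nra].
  destruct (Rle_dec 0 y) as [Hy | Hy].
  - assert (H1 := im_upper_bound a y (conj H41 H101) Hy HD2).
    assert (H2 := im_lower_bound a y (conj H41 H101) Hy HD2).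
    apply Rabs_le; lra.
  (* The expression inside the absolute value is odd in [y]. *)
  - replace (y ^ 4) with ((- y) ^ 4) in HD2 by ring.
    replace (y ^ 2) with ((- y) ^ 2) in HD2 by ring.
    assert (H1 := im_upper_bound a (- y) (conj H41 H101) ltac:(lra) HD2).
    assert (H2 := im_lower_bound a (- y) (conj H41 H101) ltac:(lra) HD2).
    rewrite sin_neg, cos_neg in H1, H2.
    replace ((- y) ^ 2) with (y ^ 2) in H1, H2 by ring.
    apply Rabs_le; lra.
Qed.

(** * The invariant half-strip and expansion outside it *)

Definition zeta (lam : R) (z : C) : C :=
  Cmult (Cmult (RtoC lam) (Cdiv z (Cplus z (RtoC 1)))) (Cexp (Copp z)).

(** Total on the plane, unlike [zeta_iter]: values after a visit to the pole [-1] carry no meaning,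
    hence the recurring assumption that [-1] is avoided. *)
Fixpoint orbit (lam : R) (n : nat) (z : C) : C :=
  match n with O => z | S m => zeta lam (orbit lam m z) end.

Definition sqmod_plus1 (z : C) : R := (fst z + 1) ^ 2 + snd z ^ 2.

Lemma zeta_re (lam : R) (z : C) : fst (zeta lam z) =
  lam * exp (- fst z) * ((fst z ^ 2 + fst z + snd z ^ 2) * cos (snd z)
    + snd z * sin (snd z)) / sqmod_plus1 z.
Proof.
  destruct z as [x y]. unfold zeta, sqmod_plus1, Cdiv, Cinv, Cmult, Cplus, Cexp, Copp, RtoC; cbn [fst snd].
  rewrite cos_neg, sin_neg. replace (y + 0) with y by ring.
  set (N := (x + 1) ^ 2 + y ^ 2).
  unfold Rdiv. ring.
Qed.

Lemma zeta_im (lam : R) (z : C) : snd (zeta lam z) =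
  lam * exp (- fst z) * (snd z * cos (snd z)
    - (fst z ^ 2 + fst z + snd z ^ 2) * sin (snd z)) / sqmod_plus1 z.
Proof.
  destruct z as [x y]. unfold zeta, sqmod_plus1, Cdiv, Cinv, Cmult, Cplus, Cexp, Copp, RtoC; cbn [fst snd].
  rewrite cos_neg, sin_neg. replace (y + 0) with y by ring.
  set (N := (x + 1) ^ 2 + y ^ 2).
  unfold Rdiv. ring.
Qed.

Lemma sqmod_plus1_Cmod (z : C) : sqmod_plus1 z = Cmod (Cplus z (RtoC 1)) ^ 2.
Proof. rewrite Cmod2_alt. destruct z as [x y]. unfold sqmod_plus1; simpl. ring. Qed.

Lemma sqmod_plus1_pos (z : C) : z <> RtoC (-1) -> 0 < sqmod_plus1 z.
Proof.
  destruct z as [x y]; unfold sqmod_plus1, RtoC; simpl fst; simpl snd; intros H.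
  destruct (Req_dec x (-1)) as [Hx | Hx].
  - assert (y <> 0) by congruence. assert (0 < y ^ 2) by (apply pow2_gt_0; easy). nra.
  - assert (0 < (x + 1) ^ 2) by (apply pow2_gt_0; lra). nra.
Qed.

Lemma Cmod_Cexp (z : C) : Cmod (Cexp z) = exp (fst z).
Proof.
  unfold Cmod, Cexp; simpl fst; simpl snd.
  transitivity (sqrt (exp (fst z) ^ 2)); [ | apply sqrt_pow2; left; apply exp_pos].
  f_equal. assert (H := sin2_cos2 (snd z)). unfold Rsqr in H.
  transitivity (exp (fst z) ^ 2 * (sin (snd z) * sin (snd z) + cos (snd z) * cos (snd z)));
    [ring | rewrite H; ring].
Qed.

Lemma plus1_neq_0 (z : C) : z <> RtoC (-1) -> Cplus z (RtoC 1) <> RtoC 0.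
Proof.
  intros H E. apply H.
  destruct z as [x y]. unfold Cplus, RtoC in *; simpl in *. injection E; intros.
  f_equal; lra.
Qed.

Lemma Cmod_zeta (lam : R) (z : C) : 0 < lam -> z <> RtoC (-1) ->
  Cmod (zeta lam z) = lam * (Cmod z / Cmod (Cplus z (RtoC 1))) * exp (- fst z).
Proof.
  intros Hl Hz. unfold zeta.
  rewrite !Cmod_mult, Cmod_Cexp, Cmod_R, Rabs_pos_eq, Cmod_div; [ | apply plus1_neq_0, Hz | lra].
  destruct z; reflexivity.
Qed.

(* [156/100] is slightly less than [PI/2], so that [cos (Im z) >= 0] on the strip. *)
Definition strip (z : C) : Prop := 0 <= fst z /\ Rabs (snd z) <= 156/100.

Lemma Cmod_sq (z : C) : Cmod z ^ 2 = fst z ^ 2 + snd z ^ 2.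
Proof. apply Cmod2_alt. Qed.

Lemma Cmod_plus1_ge (z : C) : 0 <= fst z ->
  Cmod z <= Cmod (Cplus z (RtoC 1)) /\ 1 <= Cmod (Cplus z (RtoC 1)).
Proof.
  intros H. assert (H1 := Cmod_sq z). assert (H2 := sqmod_plus1_Cmod z). unfold sqmod_plus1 in H2.
  assert (0 <= snd z ^ 2) by apply pow2_ge_0.
  split; apply Rsqr_incr_0_var; unfold Rsqr;
   try apply Cmod_ge_0; nra.
Qed.

Lemma right_half_plane_neq_pole (z : C) : 0 <= fst z -> z <> RtoC (-1).
Proof. intros H E. rewrite E in H. simpl in H. lra. Qed.

(** [|z + 1|] is at least both [|z|] and [1]. The first bound gives contraction on the strip, the
    second controls images of points far to the right. *)
Lemma Cmod_zeta_right (lam : R) (z : C) : 0 < lam -> 0 <= fst z ->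
  Cmod (zeta lam z) <= lam * Cmod z /\ Cmod (zeta lam z) <= lam * exp (- fst z).
Proof.
  intros Hl Hx. rewrite Cmod_zeta; [ | easy | apply right_half_plane_neq_pole, Hx].
  destruct (Cmod_plus1_ge z Hx) as [H1 H2].
  assert (H0 := Cmod_ge_0 z).
  assert (He := exp_pos (- fst z)).
  assert (He1 : exp (- fst z) <= 1).
  { rewrite <- exp_0. destruct Hx as [Hx | <-]; [left; apply exp_increasing; lra | right; f_equal; lra]. }
  set (d := Cmod (Cplus z (RtoC 1))) in *.
  assert (Hq : 0 <= Cmod z / d <= Cmod z).
  { split; [apply Rdiv_le_0_compat; lra | ]. apply Rle_div_l; nra. }
  assert (Hq1 : Cmod z / d <= 1) by (apply Rle_div_l; lra).
  rewrite !Rmult_assoc.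
  split; apply Rmult_le_compat_l; try lra; nra.
Qed.

Lemma y_sin_ge0 (y : R) : Rabs y <= 156/100 -> 0 <= y * sin y.
Proof.
  intros H. apply Rabs_le_between in H.
  destruct (Rle_dec 0 y).
  - assert (0 <= sin y) by (assert (H3 := PI2_3_2); apply sin_ge_0; lra). nra.
  - assert (0 <= sin (- y)) by (assert (H3 := PI2_3_2); apply sin_ge_0; lra).
    rewrite sin_neg in *. nra.
Qed.

(** The condition on [x = Re z] allows [x >= 0] as well as [x <= -1]: the sign is needed on the
    strip and near the left critical point. *)
Lemma zeta_re_ge0 (lam : R) (z : C) : 0 < lam -> z <> RtoC (-1) ->
  Rabs (snd z) <= 156/100 -> 0 <= fst z ^ 2 + fst z -> 0 <= fst (zeta lam z).
Proof.
  intros Hl Hz Hy Hx. rewrite zeta_re.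
  assert (Hc := cos_ge_0_156 _ Hy). assert (Hs := y_sin_ge0 _ Hy).
  apply Rdiv_le_0_compat; [ | apply sqmod_plus1_pos, Hz].
  apply Rmult_le_pos; [apply Rmult_le_pos; [lra | left; apply exp_pos] | ].
  assert (0 <= snd z ^ 2) by apply pow2_ge_0.
  apply Rplus_le_le_0_compat; [apply Rmult_le_pos | ]; lra.
Qed.

Lemma strip_zeta (lam : R) (z : C) : 0 < lam < 1 -> strip z -> strip (zeta lam z).
Proof.
  intros Hl [Hx Hy]. split.
  - apply zeta_re_ge0; [lra | apply right_half_plane_neq_pole, Hx | easy | nra].
  - apply Rle_trans with (Cmod (zeta lam z)).
    + eapply Rle_trans; [apply Rmax_r | apply Rmax_Cmod].
    + destruct (Cmod_zeta_right lam z) as [_ H]; [lra | easy | ].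
      assert (exp (- fst z) <= 1).
      { rewrite <- exp_0. destruct Hx as [Hx | <-]; [left; apply exp_increasing; lra | right; f_equal; lra]. }
      assert (He := exp_pos (- fst z)). nra.
Qed.

(** Since [q 0 = 1], the gain must shrink with the distance [d] from [0]. This matters only for
    [-12/10 <= x < 0]; elsewhere the constant [1/1000] works. *)
Lemma expansion_outside_strip (lam d : R) (z : C) : 0 < lam < 1 -> 0 < d <= 1/4 ->
  d <= Cmod z -> ~ strip z -> ~ strip (zeta lam z) ->
  d ^ 2 / 100 * sqmod_plus1 z <= expansion_gap (fst z) (snd z).
Proof.
  intros Hl Hd Hz Hs Hf.
  assert (Hz2 : d ^ 2 <= fst z ^ 2 + snd z ^ 2).
  { rewrite <- Cmod_sq. apply pow_incr; lra. }
  assert (Hc : 0 <= d ^ 2 / 100 <= 1/1000) by nra.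
  destruct z as [x y]. unfold sqmod_plus1. simpl fst in *; simpl snd in *.
  assert (Hy2 : 0 <= y ^ 2) by apply pow2_ge_0.
  assert (Hy4 : 0 <= y ^ 4) by (replace (y ^ 4) with ((y ^ 2) ^ 2) by ring; apply pow2_ge_0).
  destruct (Rle_dec 0 x) as [Hx | Hx]; [ | destruct (Rle_dec (-12/10) x) as [Hx' | Hx']].
  - assert (Hy : 156/100 < Rabs y) by (apply Rnot_le_lt; intro; apply Hs; split; easy).
    assert (Hyy : 24336/10000 <= y ^ 2).
    { rewrite <- pow2_abs. nra. }
    apply Rle_trans with (1/1000 * ((x + 1) ^ 2 + y ^ 2)).
    { apply Rmult_le_compat_r; [nra | lra]. }
    unfold expansion_gap.
    assert (0 <= x ^ 3) by (apply pow_le, Hx). assert (0 <= x ^ 4) by (apply pow_le, Hx).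
    assert (0 <= x ^ 2) by (apply pow_le, Hx).
    assert (24336/10000 * (2 * x ^ 2 + 2 * x + 2) <= y ^ 2 * (2 * x ^ 2 + 2 * x + 2)) by nra.
    assert (2 * y ^ 2 <= y ^ 4) by nra.
    lra.
  (* Here the gap is at least [3/10 * x^2 + y^2], hence at least a multiple of [d^2]. *)
  - unfold expansion_gap.
    assert (H1 : 4/10 <= (x + 2) * (2 - x ^ 2)).
    { apply Rle_trans with (8/10 * (56/100)); [lra | apply Rmult_le_compat; nra]. }
    assert (H2 : 3/10 * x ^ 2 <= x * (x + 2) * (x ^ 2 - 2)).
    { replace (x * (x + 2) * (x ^ 2 - 2)) with (- x * ((x + 2) * (2 - x ^ 2))) by ring.
      apply Rle_trans with (- x * (4/10)); [nra | apply Rmult_le_compat_l; lra]. }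
    assert (H3 : y ^ 2 <= y ^ 2 * (2 * x ^ 2 + 2 * x + 2)) by nra.
    assert (H4 : (x + 1) ^ 2 <= 1) by nra.
    nra.
  (* Too small a gap would put the image in the strip by [near_left_critical_point]. *)
  - apply Rnot_lt_le. intros HD. apply Hf.
    assert (HD' : expansion_gap x y < 1/1000 * ((x + 1) ^ 2 + y ^ 2)).
    { eapply Rlt_le_trans; [exact HD | apply Rmult_le_compat_r; [nra | lra]]. }
    destruct (near_left_critical_point x y) as [H1 H2]; [lra | easy | ].
    assert (Hne : (x, y) <> RtoC (-1)) by (intro E; injection E; intros; lra).
    assert (HN := sqmod_plus1_pos _ Hne).
    split.
    + apply zeta_re_ge0; simpl; try easy; nra.
    + rewrite zeta_im. unfold sqmod_plus1 in *; simpl fst in *; simpl snd in *.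
      unfold Rdiv. rewrite (Rmult_assoc lam), !Rabs_mult, Rabs_inv, (Rabs_pos_eq lam) by lra.
      rewrite Rabs_mult in H1.
      set (u := Rabs (exp (- x)) * Rabs (y * cos y - (x ^ 2 + x + y ^ 2) * sin y)) in *.
      rewrite (Rabs_pos_eq ((x + 1) ^ 2 + y ^ 2)) by lra.
      apply Rle_div_l; [lra | ].
      assert (0 <= u) by (apply Rmult_le_pos; apply Rabs_pos).
      nra.
Qed.

(** * Logarithmic derivative and the basin *)

(* [z f'(z) / f(z)] for [f = zeta lam]. *)
Definition logder (z : C) : C := Cminus (Cinv (Cplus z (RtoC 1))) z.

Lemma logder_eq (z : C) : logder z =
  ((fst z + 1) / sqmod_plus1 z - fst z, - snd z / sqmod_plus1 z - snd z).
Proof.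
  destruct z as [x y]. unfold logder, sqmod_plus1, Cminus, Cinv, Cplus, Copp, RtoC; cbn [fst snd].
  replace (y + 0) with y by ring. reflexivity.
Qed.

Lemma Cmod_logder_sq (z : C) : z <> RtoC (-1) ->
  Cmod (logder z) ^ 2 = 1 + expansion_gap (fst z) (snd z) / sqmod_plus1 z.
Proof.
  intros Hz. assert (HN := sqmod_plus1_pos z Hz).
  rewrite Cmod_sq, logder_eq. cbn [fst snd]. unfold sqmod_plus1, expansion_gap in *. field. lra.
Qed.

(** Velocities are written as [z * c], that is, in the coordinate [log z]; there one application of
    [f] multiplies [c] by [logder z]. *)
Lemma is_derive_zeta (lam : R) (X Y : R -> R) (t : R) (z c : C) :
  (X t, Y t) = z -> z <> RtoC (-1) ->
  is_derive X t (fst (Cmult z c)) -> is_derive Y t (snd (Cmult z c)) ->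
  is_derive (fun s => fst (zeta lam (X s, Y s))) t (fst (Cmult (zeta lam z) (Cmult c (logder z)))) /\
  is_derive (fun s => snd (zeta lam (X s, Y s))) t (snd (Cmult (zeta lam z) (Cmult c (logder z)))).
Proof.
  intros Ez Hz HX HY.
  assert (HN := sqmod_plus1_pos z Hz).
  destruct z as [x y], c as [c1 c2].
  injection Ez as Ex Ey.
  unfold Cmult in HX, HY; cbn [fst snd] in HX, HY.
  assert (EX : Derive (fun s : R => X s) t = x * c1 - y * c2) by exact (is_derive_unique _ _ _ HX).
  assert (EY : Derive (fun s : R => Y s) t = x * c2 + y * c1) by exact (is_derive_unique _ _ _ HY).
  split.
  - eapply is_derive_ext; [intros s; symmetry; apply zeta_re | ].
    unfold Cmult; cbn [fst snd].
    rewrite zeta_re, zeta_im, logder_eq. unfold sqmod_plus1 in *; cbn [fst snd] in *.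
    auto_derive.
    + rewrite Ex, Ey. repeat split; try (eexists; eassumption). simpl in HN; lra.
    + rewrite EX, EY, Ex, Ey. field. lra.
  - eapply is_derive_ext; [intros s; symmetry; apply zeta_im | ].
    unfold Cmult; cbn [fst snd].
    rewrite zeta_re, zeta_im, logder_eq. unfold sqmod_plus1 in *; cbn [fst snd] in *.
    auto_derive.
    + rewrite Ex, Ey. repeat split; try (eexists; eassumption). simpl in HN; lra.
    + rewrite EX, EY, Ex, Ey. field. lra.
Qed.

(** By the chain rule, [z (f^n)'(z) / f^n(z)] for [z <> 0]. *)
Fixpoint logder_orbit (lam : R) (n : nat) (z : C) : C :=
  match n with
  | O => RtoC 1
  | S m => Cmult (logder_orbit lam m z) (logder (orbit lam m z))
  end.

Lemma is_derive_orbit (lam : R) (n : nat) (X Y : R -> R) (t : R) (z c : C) :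
  (X t, Y t) = z -> (forall k, orbit lam k z <> RtoC (-1)) ->
  is_derive X t (fst (Cmult z c)) -> is_derive Y t (snd (Cmult z c)) ->
  is_derive (fun s => fst (orbit lam n (X s, Y s))) t
    (fst (Cmult (orbit lam n z) (Cmult c (logder_orbit lam n z)))) /\
  is_derive (fun s => snd (orbit lam n (X s, Y s))) t
    (snd (Cmult (orbit lam n z) (Cmult c (logder_orbit lam n z)))).
Proof.
  intros Ez Hz HX HY.
  induction n as [ | n [IH1 IH2]].
  - cbn [orbit logder_orbit]. rewrite Cmult_1_r. split; assumption.
  - cbn [orbit logder_orbit]. rewrite (Cmult_assoc c).
    assert (Eo : (fst (orbit lam n (X t, Y t)), snd (orbit lam n (X t, Y t))) = orbit lam n z)
      by (rewrite <- surjective_pairing, Ez; reflexivity).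
    destruct (is_derive_zeta lam _ _ t _ _ Eo (Hz n) IH1 IH2) as [H1 H2].
    split; [eapply is_derive_ext; [ | exact H1] | eapply is_derive_ext; [ | exact H2]];
      intros s; cbv beta; rewrite <- surjective_pairing; reflexivity.
Qed.

(** Chosen so that [(1 - trap_radius lam)^2 >= (1 + lam) / 2], whence [lam / (1 - trap_radius lam)^2
    <= trap_ratio lam < 1]. *)
Definition trap_radius (lam : R) := (1 - lam) / 4.
Definition trap_ratio (lam : R) := 2 * lam / (1 + lam).

Lemma trap_radius_bounds (lam : R) : 0 < lam < 1 -> 0 < trap_radius lam <= 1/4.
Proof. unfold trap_radius; lra. Qed.

Lemma trap_ratio_bounds (lam : R) : 0 < lam < 1 -> 0 < trap_ratio lam < 1.
Proof.
  intros H. unfold trap_ratio. split; [apply Rdiv_lt_0_compat; lra | apply Rlt_div_l; lra].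
Qed.

Lemma trapped_neq_pole (lam : R) (z : C) : 0 < lam < 1 -> Cmod z < trap_radius lam -> z <> RtoC (-1).
Proof.
  intros Hl Hz E. rewrite E, Cmod_R, Rabs_left in Hz by lra.
  destruct (trap_radius_bounds lam Hl). lra.
Qed.

(** On the disc both [|z + 1|] and [exp (Re z)] are at least [1 - trap_radius lam]. *)
Lemma zeta_trap (lam : R) (z : C) : 0 < lam < 1 -> Cmod z < trap_radius lam ->
  Cmod (zeta lam z) <= trap_ratio lam * Cmod z.
Proof.
  intros Hl Hz. destruct (trap_radius_bounds lam Hl) as [Hd0 Hd1].
  rewrite Cmod_zeta; [ | lra | apply trapped_neq_pole with lam; easy].
  assert (H0 := Cmod_ge_0 z).
  assert (H1 : 1 - trap_radius lam <= Cmod (Cplus z (RtoC 1))).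
  { assert (H := Cmod_triangle (Cplus z (RtoC 1)) (Copp z)).
    replace (Cplus (Cplus z (RtoC 1)) (Copp z)) with (RtoC 1) in H by ring.
    rewrite Cmod_opp, Cmod_1 in H. lra. }
  assert (H2 : exp (- fst z) <= / (1 - trap_radius lam)).
  { assert (Hx : Rabs (fst z) <= Cmod z)
      by (eapply Rle_trans; [apply Rmax_l | apply Rmax_Cmod]).
    apply Rabs_le_between in Hx.
    apply Rle_trans with (exp (trap_radius lam)).
    { left; apply exp_increasing; lra. }
    assert (H3 := exp_ineq1_le (- trap_radius lam)).
    rewrite <- (Rinv_inv (exp (trap_radius lam))). apply Rinv_le_contravar; [lra | ].
    rewrite <- exp_Ropp. lra. }
  set (d := Cmod (Cplus z (RtoC 1))) in *.
  assert (H3 : / d <= / (1 - trap_radius lam)) by (apply Rinv_le_contravar; lra).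
  assert (H4 : / d * exp (- fst z) <= / (1 - trap_radius lam) * / (1 - trap_radius lam)).
  { apply Rmult_le_compat; try easy; [left; apply Rinv_0_lt_compat; lra | left; apply exp_pos]. }
  assert (H5 : / (1 - trap_radius lam) * / (1 - trap_radius lam) <= 2 / (1 + lam)).
  { rewrite <- Rinv_mult. replace (2 / (1 + lam)) with (/ ((1 + lam) / 2)) by (field; lra).
    apply Rinv_le_contravar; unfold trap_radius; nra. }
  replace (lam * (Cmod z / d) * exp (- fst z)) with (lam * Cmod z * (/ d * exp (- fst z)))
    by (unfold Rdiv; ring).
  replace (trap_ratio lam * Cmod z) with (lam * Cmod z * (2 / (1 + lam))) by (unfold trap_ratio, Rdiv; ring).
  apply Rmult_le_compat_l; [apply Rmult_le_pos; lra | lra].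
Qed.

Lemma orbit_trap (lam : R) (z : C) (n : nat) : 0 < lam < 1 -> Cmod z < trap_radius lam ->
  Cmod (orbit lam n z) <= trap_ratio lam ^ n * Cmod z /\ Cmod (orbit lam n z) < trap_radius lam.
Proof.
  intros Hl Hz. assert (Hm := trap_ratio_bounds lam Hl).
  induction n as [ | n [IH1 IH2]]; [simpl; lra | ].
  simpl. assert (H := zeta_trap lam _ Hl IH2).
  assert (0 <= Cmod (orbit lam n z)) by apply Cmod_ge_0.
  split; nra.
Qed.

Lemma orbit_add (lam : R) (m n : nat) (z : C) : orbit lam (m + n) z = orbit lam m (orbit lam n z).
Proof. induction m; simpl; congruence. Qed.

(* [z = -1] is the pole, so the first clause says that all iterates stay finite. *)
Definition in_basin (lam : R) (z : C) : Prop :=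
  (forall n, orbit lam n z <> RtoC (-1)) /\ exists n, Cmod (orbit lam n z) < trap_radius lam.

Lemma orbit_strip (lam : R) (n : nat) (z : C) : 0 < lam < 1 -> strip z ->
  strip (orbit lam n z) /\ Cmod (orbit lam n z) <= lam ^ n * Cmod z.
Proof.
  intros Hl Hz. induction n as [ | n [IH1 IH2]]; [simpl; split; [easy | lra] | ].
  simpl. split; [apply strip_zeta; easy | ].
  destruct (Cmod_zeta_right lam (orbit lam n z)) as [H _]; [lra | apply IH1 | nra].
Qed.

Lemma pow_small (q M eps : R) : 0 <= q < 1 -> 0 < eps -> 0 <= M ->
  exists N, forall n, (N <= n)%nat -> q ^ n * M < eps.
Proof.
  intros Hq He HM.
  destruct (pow_lt_1_zero q) with (y := eps / (M + 1)) as [N HN].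
  - rewrite Rabs_pos_eq; lra.
  - apply Rdiv_lt_0_compat; lra.
  - exists N. intros n Hn. specialize (HN n Hn).
    assert (Hp : 0 <= q ^ n) by (apply pow_le; lra).
    rewrite Rabs_pos_eq in HN by easy.
    apply (Rmult_lt_compat_r (M + 1)) in HN; [ | lra].
    unfold Rdiv in HN. rewrite Rmult_assoc, Rinv_l, Rmult_1_r in HN; lra.
Qed.

(** Orbits in the strip contract by [lam]; from a real part beyond [1 / trap_radius lam] one step
    suffices, because [exp (- x) < 1 / x]. *)
Lemma in_basin_of_orbit (lam : R) (n : nat) (z : C) : 0 < lam < 1 ->
  (forall k, orbit lam k z <> RtoC (-1)) ->
  strip (orbit lam n z) \/ 1 / trap_radius lam < fst (orbit lam n z) \/
  Cmod (orbit lam n z) < trap_radius lam ->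
  in_basin lam z.
Proof.
  intros Hl Hz H. destruct (trap_radius_bounds lam Hl) as [Hd0 Hd1]. split; [easy | ].
  destruct H as [H | [H | H]]; [ | | exists n; exact H].
  - destruct (pow_small lam (Cmod (orbit lam n z)) (trap_radius lam)) as [N HN]; [lra | lra | apply Cmod_ge_0 | ].
    exists (N + n)%nat. rewrite orbit_add.
    eapply Rle_lt_trans; [apply orbit_strip; easy | apply HN; lia].
  - exists (S n). simpl.
    assert (0 < 1 / trap_radius lam) by (apply Rdiv_lt_0_compat; lra).
    destruct (Cmod_zeta_right lam (orbit lam n z)) as [_ H1]; [lra | lra | ].
    eapply Rle_lt_trans; [exact H1 | ].
    set (x := fst (orbit lam n z)) in *.
    assert (Hx := exp_ineq1_le x). assert (He := exp_pos (- x)).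
    assert (E : exp x * exp (- x) = 1) by (rewrite <- exp_plus, Rplus_opp_r; apply exp_0).
    assert (H2 : 1 < trap_radius lam * x) by (apply Rlt_div_l in H; lra).
    nra.
Qed.

(** * Continuity and maxima on squares *)

Lemma cont_plus {U : UniformSpace} (f g : U -> R) (z : U) :
  continuous f z -> continuous g z -> continuous (fun w => f w + g w) z.
Proof. exact (continuous_plus (V := R_NormedModule) f g z). Qed.

Lemma cont_opp {U : UniformSpace} (f : U -> R) (z : U) :
  continuous f z -> continuous (fun w => - f w) z.
Proof. exact (continuous_opp (V := R_NormedModule) f z). Qed.

Lemma cont_mult {U : UniformSpace} (f g : U -> R) (z : U) :
  continuous f z -> continuous g z -> continuous (fun w => f w * g w) z.
Proof. exact (continuous_mult (K := R_AbsRing) f g z). Qed.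

Lemma cont_comp {U : UniformSpace} (f : U -> R) (h : R -> R) (z : U) :
  continuous f z -> continuous h (f z) -> continuous (fun w => h (f w)) z.
Proof. exact (continuous_comp f h z). Qed.

Lemma cont_div {U : UniformSpace} (f g : U -> R) (z : U) :
  continuous f z -> continuous g z -> g z <> 0 ->
  continuous (fun w => f w / g w) z.
Proof.
  intros Hf Hg H0. apply cont_mult; [easy | ].
  apply (cont_comp g Rinv); [easy | apply continuous_Rinv, H0].
Qed.

Lemma cont_pow {U : UniformSpace} (f : U -> R) (n : nat) (z : U) :
  continuous f z -> continuous (fun w => f w ^ n) z.
Proof.
  intros Hf. induction n as [ | n IH]; [apply continuous_const | ].
  apply (cont_mult f (fun w => f w ^ n)); easy.
Qed.

Lemma cont_pair {U : UniformSpace} (h : U -> R * R) (z : U) : continuous (fun w => fst (h w)) z ->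
  continuous (fun w => snd (h w)) z -> continuous h z.
Proof.
  intros H1 H2.
  apply continuous_ext with (fun w => (fst (h w), snd (h w))).
  { intros w. symmetry. apply surjective_pairing. }
  apply (continuous_comp_2 (fun w => fst (h w)) (fun w => snd (h w)) (fun a b => (a, b))); try easy.
  apply continuous_ext with (fun w => w); [intros [a b]; reflexivity | apply continuous_id].
Qed.

Lemma cont_fst (z : R * R) : continuous (fun w : R * R => fst w) z.
Proof. destruct z; apply continuous_fst. Qed.

Lemma cont_snd (z : R * R) : continuous (fun w : R * R => snd w) z.
Proof. destruct z; apply continuous_snd. Qed.

Ltac cont := lazymatch goal with
  | |- continuous fst _ => apply cont_fst
  | |- continuous snd _ => apply cont_snd
  | |- continuous (fun w => fst w) _ => apply cont_fst
  | |- continuous (fun w => snd w) _ => apply cont_snd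
  | |- continuous (fun w => @?f w + @?g w) _ => apply (cont_plus f g); cont
  | |- continuous (fun w => @?f w * @?g w) _ => apply (cont_mult f g); cont
  | |- continuous (fun w => - @?f w) _ => apply (cont_opp f); cont
  | |- continuous (fun w => @?f w ^ ?n) _ => apply (cont_pow f n); cont
  | |- continuous (fun w => exp (@?f w)) _ =>
      apply (cont_comp f exp); [cont | apply continuous_exp]
  | |- continuous (fun w => cos (@?f w)) _ =>
      apply (cont_comp f cos); [cont | apply continuous_cos]
  | |- continuous (fun w => sin (@?f w)) _ =>
      apply (cont_comp f sin); [cont | apply continuous_sin]
  | |- continuous (fun w => sqrt (@?f w)) _ =>
      apply (cont_comp f sqrt); [cont | apply continuous_sqrt]
  | |- _ => apply continuous_const
  end.

Lemma continuous_zeta (lam : R) (z : R * R) : z <> RtoC (-1) ->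
  continuous (fun w : R * R => (zeta lam w : R * R)) z.
Proof.
  intros Hz. assert (HN := sqmod_plus1_pos z Hz).
  apply cont_pair.
  - eapply continuous_ext; [intros w; symmetry; apply zeta_re | ].
    apply cont_div; [unfold Rminus; cont | unfold sqmod_plus1; cont | lra].
  - eapply continuous_ext; [intros w; symmetry; apply zeta_im | ].
    apply cont_div; [unfold Rminus; cont | unfold sqmod_plus1; cont | lra].
Qed.

Lemma continuous_orbit (lam : R) (n : nat) (z : R * R) :
  (forall k, (k < n)%nat -> orbit lam k z <> RtoC (-1)) ->
  continuous (fun w : R * R => (orbit lam n w : R * R)) z.
Proof.
  intros Hz. induction n as [ | n IH]; [apply continuous_id | ].
  apply (continuous_comp (fun w : R * R => orbit lam n w : R * R) (fun w : R * R => zeta lam w : R * R)).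
  - apply IH. intros k Hk. apply Hz; lia.
  - apply continuous_zeta, Hz; lia.
Qed.

Definition square (z0 : R * R) (r : R) (z : R * R) : Prop :=
  Rabs (fst z - fst z0) <= r /\ Rabs (snd z - snd z0) <= r.

(** If the supremum [s] were not attained, compactness would turn the pointwise gaps [s - g z] into
    a uniform one, contradicting the choice of [s]. *)
Lemma max_on_square (g : R * R -> R) (z0 : R * R) (r M : R) : 0 <= r ->
  (forall z, square z0 r z -> continuous g z) ->
  (forall z, square z0 r z -> g z <= M) ->
  exists z, square z0 r z /\ forall w, square z0 r w -> g w <= g z.
Proof.
  intros Hr Hc HM.
  destruct (completeness (fun v => exists z, square z0 r z /\ g z = v)) as [s [Hs1 Hs2]].
  { exists M. intros v [z [Hz <-]]. apply HM, Hz. }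
  { exists (g z0), z0. split; [ | easy].
    split; rewrite Rminus_diag, Rabs_R0; easy. }
  apply NNPP. intros Hn.
  assert (Hlt : forall z, square z0 r z -> g z < s).
  { intros z Hz. apply Rnot_le_lt. intros Hsz. apply Hn. exists z. split; [easy | ].
    intros w Hw. apply Rle_trans with s; [apply Hs1; exists w; easy | easy]. }
  (* [d] serves both as a radius and as a margin below [s], so a uniform lower bound for it bounds
     [g] away from [s]. *)
  assert (Hd : forall u v, exists d : posreal, square z0 r (u, v) ->
     d <= (s - g (u, v)) / 2 /\
     forall x y, Rabs (x - u) < d -> Rabs (y - v) < d -> g (x, y) <= g (u, v) + (s - g (u, v)) / 2).
  { intros u v. destruct (classic (square z0 r (u, v))) as [Hq | Hq];
      [ | exists (mkposreal 1 Rlt_0_1); easy].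
    assert (He : 0 < (s - g (u, v)) / 2) by (specialize (Hlt _ Hq); lra).
    destruct (proj1 (filterlim_locally _ _) (Hc _ Hq) (mkposreal _ He)) as [d Hd].
    assert (Hmin : 0 < Rmin d ((s - g (u, v)) / 2)) by (apply Rmin_pos; [apply cond_pos | easy]).
    exists (mkposreal _ Hmin). intros _. simpl. split; [apply Rmin_r | ].
    intros x y Hx Hy.
    assert (Hb : ball (g (u, v)) ((s - g (u, v)) / 2) (g (x, y))).
    { apply (Hd (x, y)). split; simpl.
      - apply Rlt_le_trans with (1 := Hx), Rmin_l.
      - apply Rlt_le_trans with (1 := Hy), Rmin_l. }
    apply Rabs_lt_between in Hb. change (minus (g (x, y)) (g (u, v))) with (g (x, y) - g (u, v)) in Hb.
    lra. }
  pose (delta := fun u v => proj1_sig (constructive_indefinite_description _ (Hd u v))).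
  destruct (compactness_value_2d (fst z0 - r) (fst z0 + r) (snd z0 - r) (snd z0 + r) delta)
    as [d Hcov].
  assert (Hub : forall z, square z0 r z -> g z <= s - d).
  { intros [x y] [Hx Hy]. simpl in Hx, Hy. apply Rabs_le_between in Hx, Hy.
    destruct (NNPP _ (Hcov x y ltac:(lra) ltac:(lra))) as [u [v [Hu [Hv [Hxu [Hyv Hdd]]]]]].
    assert (Hq : square z0 r (u, v)) by (split; simpl; apply Rabs_le; lra).
    unfold delta in *. destruct (constructive_indefinite_description _ (Hd u v)) as [e He].
    simpl in *. destruct (He Hq) as [He1 He2]. specialize (He2 x y Hxu Hyv). lra. }
  assert (s <= s - d).
  { apply Hs2. intros v [z [Hz <-]]. apply Hub, Hz. }
  assert (Hdp := cond_pos d). lra.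
Qed.

(** * Density of the basin *)

(** [sin t / (1 - cos t)] for [t = arg w]: smooth off the nonnegative reals, all of which lie in
    [strip]. *)
Definition cot_half_arg (w : C) : R := snd w / (Cmod w - fst w).

Lemma Rabs_fst_le (w : C) : Rabs (fst w) <= Cmod w.
Proof. eapply Rle_trans; [apply Rmax_l | apply Rmax_Cmod]. Qed.

Lemma Rabs_snd_le (w : C) : Rabs (snd w) <= Cmod w.
Proof. eapply Rle_trans; [apply Rmax_r | apply Rmax_Cmod]. Qed.

Lemma Cmod_le_sum (w : C) : Cmod w <= Rabs (fst w) + Rabs (snd w).
Proof.
  assert (H := Cmod_sq w). assert (H0 := Cmod_ge_0 w).
  assert (H1 := Rabs_pos (fst w)). assert (H2 := Rabs_pos (snd w)).
  rewrite <- (pow2_abs (fst w)), <- (pow2_abs (snd w)) in H. nra.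
Qed.

(** For [Re w < 0] the denominator exceeds [|Im w|]. Otherwise
    [(Im w)^2 = (|w| - Re w) (|w| + Re w)] turns the modulus of the quotient into
    [(|w| + Re w) / |Im w|], where [|Im w| > 156/100]. *)
Lemma cot_half_arg_bound (d : R) (w : C) : 0 < d ->
  d <= Cmod w -> ~ strip w -> fst w <= 1 / d ->
  0 < Cmod w - fst w /\ Rabs (cot_half_arg w) <= 2 / d + 1.
Proof.
  intros Hd Hw Hs Hx.
  assert (Hd1 : 0 < 1 / d) by (apply Rdiv_lt_0_compat; lra).
  replace (2 / d) with (2 * (1 / d)) by (field; lra).
  assert (H2 := Cmod_sq w). assert (H3 := Rabs_snd_le w). assert (H4 := Cmod_le_sum w).
  assert (Hy0 := Rabs_pos (snd w)).
  unfold cot_half_arg.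
  assert (Key : 0 < Cmod w - fst w /\ Rabs (snd w) <= (2 * (1 / d) + 1) * (Cmod w - fst w)).
  { destruct (Rle_dec 0 (fst w)) as [Hx0 | Hx0].
    - assert (Hy : 156/100 < Rabs (snd w)).
      { apply Rnot_le_lt. intros H. apply Hs. split; easy. }
      rewrite Rabs_pos_eq in H4 by easy.
      rewrite <- (pow2_abs (snd w)) in H2.
      set (y := Rabs (snd w)) in *. set (x := fst w) in *. set (m := Cmod w) in *.
      assert (Hm : 0 < m - x) by nra. split; [easy | ].
      assert (Hp : y * y = (m - x) * (m + x)) by (ring_simplify; lra).
      assert (Hq : m + x <= (2 * (1 / d) + 1) * y) by nra.
      apply Rmult_le_reg_r with y; [lra | ].
      rewrite Hp. nra.
    - split; [lra | ]. nra. }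
  destruct Key as [K1 K2]. split; [easy | ].
  unfold Rdiv at 1. rewrite Rabs_mult, Rabs_inv, (Rabs_pos_eq (Cmod w - fst w)) by lra.
  apply Rle_div_l; lra.
Qed.

(* The hypotheses on the derivatives say that [w] is rotated about [0] with unit angular speed. *)
Lemma is_derive_cot_half_arg (X Y : R -> R) (t : R) (w : C) : (X t, Y t) = w ->
  is_derive X t (- snd w) -> is_derive Y t (fst w) -> 0 < Cmod w - fst w ->
  is_derive (fun s => cot_half_arg (X s, Y s)) t (- (Cmod w / (Cmod w - fst w))).
Proof.
  intros Ew HX HY Hw.
  assert (Hm := Cmod_sq w).
  assert (Hm0 : 0 < Cmod w).
  { assert (H := Cmod_ge_0 w). assert (Ha := Rabs_fst_le w).
    destruct H as [H | H]; [easy | ].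
    rewrite <- H in Ha, Hw. apply Rabs_le_between in Ha. lra. }
  destruct w as [x y]. injection Ew as Ex Ey. cbn [fst snd] in *.
  assert (EX : Derive (fun s : R => X s) t = - y) by exact (is_derive_unique _ _ _ HX).
  assert (EY : Derive (fun s : R => Y s) t = x) by exact (is_derive_unique _ _ _ HY).
  unfold cot_half_arg. unfold Cmod in *. cbn [fst snd] in *.
  assert (Hpos : 0 < x ^ 2 + y ^ 2).
  { apply Rnot_le_lt. intros H. rewrite sqrt_neg_0 in Hm0 by easy. lra. }
  simpl in Hpos.
  auto_derive.
  - rewrite Ex, Ey. repeat split; try (eexists; eassumption); simpl in *; lra.
  - rewrite EX, EY, Ex, Ey. simpl in *.
    set (s := sqrt (x * (x * 1) + y * (y * 1))) in *.
    assert (Hyy : y * y = s * s - x * x) by lra.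
    transitivity (x / (s - x) - (y * y) / ((s - x) * (s - x))); [field; lra | ].
    rewrite Hyy. field. lra.
Qed.

(** The lower bound for [|q|] that [expansion_outside_strip] gives with [d = trap_radius lam]. *)
Definition rate (lam : R) : R := sqrt (1 + trap_radius lam ^ 2 / 100).

Lemma rate_gt_1 (lam : R) : 0 < lam < 1 -> 1 < rate lam.
Proof.
  intros Hlam.
  unfold rate. rewrite <- sqrt_1 at 1. apply sqrt_lt_1; destruct (trap_radius_bounds lam Hlam); nra.
Qed.

Lemma orbit_outside_basin (lam : R) (z : C) (n : nat) : 0 < lam < 1 ->
  (forall k, orbit lam k z <> RtoC (-1)) -> ~ in_basin lam z ->
  trap_radius lam <= Cmod (orbit lam n z) /\ ~ strip (orbit lam n z) /\
  fst (orbit lam n z) <= 1 / trap_radius lam.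
Proof.
  intros Hlam Hz Hn.
  repeat split.
  - apply Rnot_lt_le. intros H. apply Hn. apply in_basin_of_orbit with n; tauto.
  - intros H. apply Hn. apply in_basin_of_orbit with n; tauto.
  - apply Rnot_lt_le. intros H. apply Hn. apply in_basin_of_orbit with n; tauto.
Qed.

Lemma Cmod_logder_ge (lam : R) (z : C) (n : nat) : 0 < lam < 1 ->
  (forall k, orbit lam k z <> RtoC (-1)) -> ~ in_basin lam z ->
  rate lam <= Cmod (logder (orbit lam n z)).
Proof.
  intros Hlam Hz Hn.
  destruct (orbit_outside_basin lam z n Hlam Hz Hn) as [H1 [H2 _]].
  destruct (orbit_outside_basin lam z (S n) Hlam Hz Hn) as [_ [H3 _]].
  assert (Hg := expansion_outside_strip lam (trap_radius lam) (orbit lam n z)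
    Hlam (trap_radius_bounds lam Hlam) H1 H2 H3).
  assert (HN := sqmod_plus1_pos _ (Hz n)).
  unfold rate. rewrite <- (sqrt_pow2 (Cmod _)) by apply Cmod_ge_0.
  apply sqrt_le_1_alt. rewrite Cmod_logder_sq by apply Hz.
  apply Rplus_le_compat_l. apply (Rle_div_r (trap_radius lam ^ 2 / 100)); [exact HN | exact Hg].
Qed.

Lemma Cmod_logder_orbit_ge (lam : R) (z : C) (n : nat) : 0 < lam < 1 ->
  (forall k, orbit lam k z <> RtoC (-1)) -> ~ in_basin lam z ->
  rate lam ^ n <= Cmod (logder_orbit lam n z).
Proof.
  intros Hlam Hz Hn. assert (Hr := rate_gt_1 lam Hlam). induction n as [ | n IH].
  - simpl. rewrite Cmod_1. lra.
  - cbn [logder_orbit]. rewrite Cmod_mult. simpl pow. rewrite Rmult_comm.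
    apply Rmult_le_compat; [apply pow_le; lra | lra | easy | apply Cmod_logder_ge; easy].
Qed.

Lemma basin_dense (lam : R) (z0 : C) (r : R) : 0 < lam < 1 -> 0 < r ->
  (forall z n, square z0 r z -> orbit lam n z <> RtoC (-1)) ->
  exists z, square z0 r z /\ in_basin lam z.
Proof.
  intros Hlam Hr Hdef. apply NNPP. intros Hno.
  assert (Hnb : forall z, square z0 r z -> ~ in_basin lam z) by (intros z Hz Hb; apply Hno; exists z; easy).
  destruct (trap_radius_bounds lam Hlam) as [Hd0 Hd1].
  set (B := 2 / trap_radius lam + 1).
  assert (HB : 0 < B) by (assert (0 < 2 / trap_radius lam) by (apply Rdiv_lt_0_compat; lra); unfold B; lra).
  assert (HPhi : forall z n, square z0 r z -> 0 < Cmod (orbit lam n z) - fst (orbit lam n z) /\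
     Rabs (cot_half_arg (orbit lam n z)) <= B).
  { intros z n Hz. destruct (orbit_outside_basin lam z n) as [H1 [H2 H3]]; [easy | intros; apply Hdef, Hz | apply Hnb, Hz | ].
    apply cot_half_arg_bound; easy. }
  (* At distance [r] from [z0] the penalty is [2 * B + 1], more than the cotangent can vary, so the
     maximum is interior. *)
  set (L := (2 * B + 1) / r ^ 2).
  assert (Hr2 : 0 < r ^ 2) by (apply pow_lt, Hr).
  assert (HL : L * r ^ 2 = 2 * B + 1) by (unfold L; field; lra).
  assert (HL0 : 0 < L) by (apply Rdiv_lt_0_compat; lra).
  clearbody L.
  (* Bounds [|z|] on the square. *)
  set (R0 := Cmod z0 + 2 * r).
  assert (HR0 : 0 <= R0) by (assert (H := Cmod_ge_0 z0); unfold R0; lra).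
  assert (Hrate := rate_gt_1 lam Hlam).
  destruct (pow_small (/ rate lam) (4 * L * r * R0) (1/2)) as [n Hn].
  { split; [left; apply Rinv_0_lt_compat; lra | ]. rewrite <- Rinv_1. apply Rinv_lt_contravar; lra. }
  { lra. }
  { repeat apply Rmult_le_pos; lra. }
  specialize (Hn n (Nat.le_refl n)).
  set (Psi := fun z : R * R => cot_half_arg (orbit lam n z)
     - L * ((fst z - fst z0) ^ 2 + (snd z - snd z0) ^ 2)).
  assert (Hsq0 : square z0 r z0) by (split; rewrite Rminus_diag, Rabs_R0; lra).
  destruct (max_on_square Psi z0 r B) as [z [Hz Hmax]]; [lra | | | ].
  { intros z Hz. unfold Psi, Rminus. apply cont_plus; [ | cont].
    apply (continuous_comp (fun w : R * R => orbit lam n w : R * R) cot_half_arg).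
    - apply continuous_orbit. intros; apply Hdef, Hz.
    - unfold cot_half_arg. apply cont_div; [cont | unfold Cmod, Rminus; cont | ].
      destruct (HPhi z n Hz). lra. }
  { intros z Hz. destruct (HPhi z n Hz) as [_ H]. apply Rabs_le_between in H. unfold Psi.
    assert (0 <= (fst z - fst z0) ^ 2) by apply pow2_ge_0.
    assert (0 <= (snd z - snd z0) ^ 2) by apply pow2_ge_0. nra. }
  destruct (HPhi z n Hz) as [Hw HPz].
  assert (Hin : Rabs (fst z - fst z0) < r /\ Rabs (snd z - snd z0) < r).
  { assert (Hm0 := Hmax z0 Hsq0). unfold Psi in Hm0.
    destruct (HPhi z0 n Hsq0) as [_ H0]. apply Rabs_le_between in H0, HPz.
    rewrite !Rminus_diag in Hm0.
    assert (Hlt : L * ((fst z - fst z0) ^ 2 + (snd z - snd z0) ^ 2) < L * r ^ 2) by lra.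
    apply Rmult_lt_reg_l in Hlt; [ | easy].
    rewrite <- (pow2_abs (fst z - fst z0)), <- (pow2_abs (snd z - snd z0)) in Hlt.
    assert (H1 := Rabs_pos (fst z - fst z0)). assert (H2 := Rabs_pos (snd z - snd z0)).
    split; nra. }
  destruct Hin as [Hin1 Hin2].
  assert (Horb : forall k, orbit lam k z <> RtoC (-1)) by (intros; apply Hdef, Hz).
  assert (HQ := Cmod_logder_orbit_ge lam z n Hlam Horb (Hnb z Hz)).
  set (Q := logder_orbit lam n z) in *.
  assert (Hrn : 0 < rate lam ^ n) by (apply pow_lt; lra).
  assert (HQ0 : Q <> RtoC 0) by (apply Cmod_gt_0; lra).
  (* The derivative of [f^n] at [z] sends [eta = z * i / Q] to [i * f^n z], the velocity of a
     rotation with unit angular speed. *)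
  destruct (ex_intro (fun e => e = Cmult z (Cdiv Ci Q)) _ eq_refl) as [eta Eeta].
  assert (Heta : Cmod eta <= (/ rate lam) ^ n * R0).
  { rewrite Eeta, Cmod_mult, Cmod_div, Cmod_Ci by easy.
    rewrite pow_inv, Rmult_comm.
    apply Rmult_le_compat; [apply Rdiv_le_0_compat; lra | apply Cmod_ge_0 | | ].
    - unfold Rdiv. rewrite Rmult_1_l. apply Rinv_le_contravar; lra.
    - assert (Ht := Cmod_triangle z0 (Cminus z z0)).
      assert (Et : forall a b : C, Cplus b (Cminus a b) = a) by (intros; ring). rewrite Et in Ht.
      assert (Hs := Cmod_le_sum (Cminus z z0)).
      destruct Hz as [Hz1 Hz2].
      change (fst (Cminus z z0)) with (fst z - fst z0) in Hs.
      change (snd (Cminus z z0)) with (snd z - snd z0) in Hs. unfold R0; lra. }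
  set (X := fun t : R => fst z + t * fst eta).
  set (Y := fun t : R => snd z + t * snd eta).
  assert (E0 : (X 0, Y 0) = z).
  { unfold X, Y. rewrite !Rmult_0_l, !Rplus_0_r. symmetry; apply surjective_pairing. }
  destruct (is_derive_orbit lam n X Y 0 z (Cdiv Ci Q) E0 Horb) as [HdX HdY].
  { rewrite <- Eeta. unfold X. auto_derive; [easy | ring]. }
  { rewrite <- Eeta. unfold Y. auto_derive; [easy | ring]. }
  fold Q in HdX, HdY.
  replace (Cmult (Cdiv Ci Q) Q) with Ci in HdX, HdY by (field; easy).
  set (w := orbit lam n z) in *.
  replace (fst (Cmult w Ci)) with (- snd w) in HdX by (unfold Cmult, Ci; simpl; ring).
  replace (snd (Cmult w Ci)) with (fst w) in HdY by (unfold Cmult, Ci; simpl; ring).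
  assert (Ew : (fst (orbit lam n (X 0, Y 0)), snd (orbit lam n (X 0, Y 0))) = w)
    by (rewrite <- surjective_pairing, E0; reflexivity).
  assert (HdP := is_derive_cot_half_arg _ _ 0 w Ew HdX HdY Hw).
  (* The derivative of [Psi] in the direction [eta]. The cotangent contributes at most [- 1/2], the
     penalty less than [1/2] in modulus, so [l] cannot vanish. *)
  set (l := - (Cmod w / (Cmod w - fst w))
     - L * (2 * ((fst z - fst z0) * fst eta + (snd z - snd z0) * snd eta))).
  assert (HdPsi : is_derive (fun t => Psi (X t, Y t)) 0 l).
  { unfold Psi, l. cbn [fst snd].
    apply (is_derive_minus (V := R_NormedModule) (fun t => cot_half_arg (orbit lam n (X t, Y t)))
       (fun t => L * ((X t - fst z0) ^ 2 + (Y t - snd z0) ^ 2))).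
    - eapply is_derive_ext; [ | exact HdP]. intros t; cbv beta. rewrite <- surjective_pairing; reflexivity.
    - unfold X, Y. auto_derive; [easy | ring]. }
  assert (Hl0 : l = 0).
  { apply is_derive_Reals in HdPsi.
    set (S := 1 + Rabs (fst eta) + Rabs (snd eta)).
    assert (P1 := Rabs_pos (fst eta)). assert (P2 := Rabs_pos (snd eta)).
    assert (HS : 1 <= S) by (unfold S; lra).
    (* For [|t| < e] the point [z + t * eta] stays in the square. *)
    set (e := Rmin (r - Rabs (fst z - fst z0)) (r - Rabs (snd z - snd z0)) / S).
    assert (He : 0 < e) by (apply Rdiv_lt_0_compat; [apply Rmin_pos; lra | lra]).
    apply (deriv_maximum (fun t => Psi (X t, Y t)) (- e) e 0 (exist _ l HdPsi)); [lra | lra | ].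
    intros t Ht1 Ht2. cbv beta. rewrite E0. apply Hmax.
    assert (HtS : Rabs t * S <= Rmin (r - Rabs (fst z - fst z0)) (r - Rabs (snd z - snd z0))).
    { apply Rle_div_r; [lra | ]. fold e. apply Rabs_le; lra. }
    assert (M1 := Rmin_l (r - Rabs (fst z - fst z0)) (r - Rabs (snd z - snd z0))).
    assert (M2 := Rmin_r (r - Rabs (fst z - fst z0)) (r - Rabs (snd z - snd z0))).
    assert (P3 := Rabs_pos t).
    split; unfold X, Y; cbn [fst snd].
    - replace (fst z + t * fst eta - fst z0) with ((fst z - fst z0) + t * fst eta) by ring.
      eapply Rle_trans; [apply Rabs_triang | ]. rewrite Rabs_mult. unfold S in HtS. nra.
    - replace (snd z + t * snd eta - snd z0) with ((snd z - snd z0) + t * snd eta) by ring.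
      eapply Rle_trans; [apply Rabs_triang | ]. rewrite Rabs_mult. unfold S in HtS. nra. }
  assert (Hhalf : 1/2 <= Cmod w / (Cmod w - fst w)).
  { apply (Rle_div_r (1/2)); [lra | ]. assert (Ha := Rabs_fst_le w). apply Rabs_le_between in Ha. lra. }
  assert (Hpen : Rabs ((fst z - fst z0) * fst eta + (snd z - snd z0) * snd eta) <= r * Cmod eta + r * Cmod eta).
  { eapply Rle_trans; [apply Rabs_triang | ]. rewrite !Rabs_mult.
    apply Rplus_le_compat; apply Rmult_le_compat; try apply Rabs_pos; try lra;
      (apply Rabs_fst_le || apply Rabs_snd_le). }
  apply Rabs_le_between in Hpen. unfold l in Hl0.
  set (p := (fst z - fst z0) * fst eta + (snd z - snd z0) * snd eta) in *.
  assert (Hfin : L * (2 * (r * Cmod eta + r * Cmod eta)) < 1/2).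
  { eapply Rle_lt_trans; [ | exact Hn].
    replace (L * (2 * (r * Cmod eta + r * Cmod eta))) with (4 * L * r * Cmod eta) by ring.
    replace ((/ rate lam) ^ n * (4 * L * r * R0)) with (4 * L * r * ((/ rate lam) ^ n * R0)) by ring.
    apply Rmult_le_compat_l; [repeat apply Rmult_le_pos; lra | easy]. }
  nra.
Qed.

(** * Chordal metric and the Fatou set *)

Lemma chord_sym (a b : Chat) : chord a b = chord b a.
Proof.
  destruct a as [z | ], b as [w | ]; try reflexivity. simpl.
  replace (Cminus z w) with (Copp (Cminus w z)) by ring.
  rewrite Cmod_opp, Rmult_comm with (r1 := 1 + _). reflexivity.
Qed.

Lemma chord_refl (a : Chat) : chord a a = 0.
Proof.
  destruct a as [z | ]; [ | reflexivity]. simpl.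
  replace (Cminus z z) with (RtoC 0) by ring. rewrite Cmod_0. unfold Rdiv; ring.
Qed.

Lemma sqrt_1_sq_bounds (m : R) : 0 <= m -> 1 <= sqrt (1 + m ^ 2) <= 1 + m.
Proof.
  intros Hm. split.
  - rewrite <- sqrt_1 at 1. apply sqrt_le_1_alt. nra.
  - rewrite <- (sqrt_pow2 (1 + m)) by lra. apply sqrt_le_1_alt. nra.
Qed.

Lemma chord_le (z w : C) : chord (Some z) (Some w) <= 2 * Cmod (Cminus z w).
Proof.
  simpl. assert (H := Cmod_ge_0 (Cminus z w)).
  change (Cmod z * (Cmod z * 1)) with (Cmod z ^ 2). change (Cmod w * (Cmod w * 1)) with (Cmod w ^ 2).
  rewrite sqrt_mult by (assert (Ha := pow2_ge_0 (Cmod z)); assert (Hb := pow2_ge_0 (Cmod w)); lra).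
  assert (H1 := sqrt_1_sq_bounds _ (Cmod_ge_0 z)).
  assert (H2 := sqrt_1_sq_bounds _ (Cmod_ge_0 w)).
  assert (1 <= sqrt (1 + Cmod z ^ 2) * sqrt (1 + Cmod w ^ 2)) by nra.
  apply Rle_div_l; nra.
Qed.

(** With [K = |z|] and [d = |u - z|], the hypothesis gives [2 d < r (1 + K) (1 + K + d)]; the term
    [r (1 + K) d <= d] is absorbed on the left. Infinity is too far away. *)
Lemma chord_near (z : C) (v : Chat) (r : R) : chord (Some z) v < r -> r * (1 + Cmod z) <= 1 ->
  exists u, v = Some u /\ Cmod (Cminus u z) <= r * (1 + Cmod z) ^ 2.
Proof.
  intros Hc Hr. assert (Hz := Cmod_ge_0 z).
  assert (H1 := sqrt_1_sq_bounds _ Hz).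
  destruct v as [u | ]; simpl in Hc;
    change (Cmod z * (Cmod z * 1)) with (Cmod z ^ 2) in Hc.
  - exists u. split; [reflexivity | ].
    change (Cmod u * (Cmod u * 1)) with (Cmod u ^ 2) in Hc.
    rewrite sqrt_mult in Hc by (assert (Ha := pow2_ge_0 (Cmod z)); assert (Hb := pow2_ge_0 (Cmod u)); lra).
    assert (Hu := Cmod_ge_0 u).
    assert (H2 := sqrt_1_sq_bounds _ Hu).
    replace (Cmod (Cminus z u)) with (Cmod (Cminus u z)) in Hc
      by (replace (Cminus z u) with (Copp (Cminus u z)) by ring; symmetry; apply Cmod_opp).
    assert (Ht := Cmod_triangle z (Cminus u z)).
    replace (Cplus z (Cminus u z)) with u in Ht by ring.
    assert (Hd := Cmod_ge_0 (Cminus u z)).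
    set (d := Cmod (Cminus u z)) in *. set (K := Cmod z) in *.
    set (S1 := sqrt (1 + K ^ 2)) in *. set (S2 := sqrt (1 + Cmod u ^ 2)) in *.
    assert (HS : 0 < S1 * S2) by nra.
    apply Rlt_div_l in Hc; [ | easy].
    assert (Hr0 : 0 < r) by nra.
    assert (HSS : S1 * S2 <= (1 + K) * (1 + K + d)) by (apply Rmult_le_compat; lra).
    assert (r * (S1 * S2) <= r * ((1 + K) * (1 + K + d))) by (apply Rmult_le_compat_l; lra).
    assert (r * (1 + K) * d <= 1 * d) by (apply Rmult_le_compat_r; lra).
    nra.
  - exfalso. apply Rlt_div_l in Hc; [ | lra].
    assert (0 < r) by nra.
    assert (r * sqrt (1 + Cmod z ^ 2) <= r * (1 + Cmod z)) by (apply Rmult_le_compat_l; lra).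
    lra.
Qed.

Lemma chord_near_eps (z : C) (e : R) : 0 < e ->
  exists r, 0 < r /\ forall v, chord (Some z) v < r -> exists u, v = Some u /\ Cmod (Cminus u z) < e.
Proof.
  intros He. assert (Hz := Cmod_ge_0 z).
  set (K := 1 + Cmod z). assert (HK : 1 <= K) by (unfold K; lra).
  exists (Rmin (/ K) (e / (2 * K ^ 2))).
  assert (HK2 : 0 < K ^ 2) by (apply pow_lt; lra).
  split.
  - apply Rmin_pos; [apply Rinv_0_lt_compat; lra | apply Rdiv_lt_0_compat; lra].
  - intros v Hv.
    destruct (chord_near z v _ Hv) as [u [-> Hu]].
    + fold K. apply Rle_trans with (/ K * K); [apply Rmult_le_compat_r; [lra | apply Rmin_l] | ].
      rewrite Rinv_l; lra.
    + fold K in Hu. exists u. split; [reflexivity | ]. eapply Rle_lt_trans; [exact Hu | ].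
      apply Rle_lt_trans with (e / (2 * K ^ 2) * K ^ 2).
      * apply Rmult_le_compat_r; [lra | apply Rmin_r].
      * replace (e / (2 * K ^ 2) * K ^ 2) with (e / 2) by (field; lra). lra.
Qed.

Lemma orbit_continuity (lam : R) (n : nat) (z : C) (e : R) :
  (forall k, (k < n)%nat -> orbit lam k z <> RtoC (-1)) -> 0 < e ->
  exists d, 0 < d /\ forall v, Cmod (Cminus v z) < d -> Cmod (Cminus (orbit lam n v) (orbit lam n z)) < e.
Proof.
  intros Hz He.
  assert (He2 : 0 < e / 2) by lra.
  destruct (proj1 (filterlim_locally _ _) (continuous_orbit lam n z Hz) (mkposreal _ He2)) as [d Hd].
  exists d. split; [apply cond_pos | ].
  intros v Hv. destruct (Hd v) as [H1 H2].
  - split.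
    + apply Rle_lt_trans with (2 := Hv). apply (Rabs_fst_le (Cminus v z)).
    + apply Rle_lt_trans with (2 := Hv). apply (Rabs_snd_le (Cminus v z)).
  - eapply Rle_lt_trans; [apply Cmod_le_sum | ].
    change (Rabs (fst (orbit lam n v) - fst (orbit lam n z)) < e / 2) in H1.
    change (Rabs (snd (orbit lam n v) - snd (orbit lam n z)) < e / 2) in H2.
    change (Rabs (fst (orbit lam n v) - fst (orbit lam n z)) + Rabs (snd (orbit lam n v) - snd (orbit lam n z)) < e).
    lra.
Qed.

(** Continuity of [chord (Some z)] in Euclidean coordinates takes the place of the triangle
    inequality. *)
Lemma chord_ball_open (z w : C) (r : R) : chord (Some z) (Some w) < r ->
  exists r', 0 < r' /\ forall v, chord (Some w) v < r' -> chord (Some z) v < r.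
Proof.
  intros Hw.
  assert (Hc : continuous (fun v : R * R => chord (Some z) (Some (v : C))) w).
  { simpl. apply cont_div.
    - unfold Cmod. change (Cminus z) with (fun v : R * R => (fst z - fst v, snd z - snd v)).
      cbn [fst snd]. unfold Rminus. cont.
    - unfold Cmod. cont.
    - apply Rgt_not_eq, sqrt_lt_R0.
      change (Cmod z * (Cmod z * 1)) with (Cmod z ^ 2). change (Cmod w * (Cmod w * 1)) with (Cmod w ^ 2).
      assert (Ha := pow2_ge_0 (Cmod z)); assert (Hb := pow2_ge_0 (Cmod w)).
      apply Rmult_lt_0_compat; lra. }
  assert (He : 0 < r - chord (Some z) (Some w)) by lra.
  destruct (proj1 (filterlim_locally _ _) Hc (mkposreal _ He)) as [d Hd].
  destruct (chord_near_eps w d (cond_pos d)) as [r' [Hr' H]].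
  exists r'. split; [easy | ]. intros v Hv. destruct (H v Hv) as [u [-> Hu]].
  assert (Hb : ball (chord (Some z) (Some w)) (r - chord (Some z) (Some w)) (chord (Some z) (Some u))).
  { apply (Hd u). split.
    - apply Rle_lt_trans with (2 := Hu). apply (Rabs_fst_le (Cminus u w)).
    - apply Rle_lt_trans with (2 := Hu). apply (Rabs_snd_le (Cminus u w)). }
  change (Rabs (chord (Some z) (Some u) - chord (Some z) (Some w)) < r - chord (Some z) (Some w)) in Hb.
  apply Rabs_lt_between in Hb. lra.
Qed.

(** * Iterates on the sphere and orbits in the plane *)

Lemma zeta_step_finite (lam : R) (z : C) : z <> RtoC (-1) ->
  zeta_step lam (Some z) = Some (Some (zeta lam z)).
Proof.
  intros Hz. unfold zeta_step. destruct (Req_EM_T _ 0) as [E | _]; [ | reflexivity].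
  exfalso. apply (plus1_neq_0 z Hz). apply Cmod_eq_0, E.
Qed.

Lemma zeta_step_pole (lam : R) : zeta_step lam (Some (RtoC (-1))) = Some None.
Proof.
  unfold zeta_step. destruct (Req_EM_T _ 0) as [_ | E]; [reflexivity | ].
  exfalso. apply E. replace (Cplus (RtoC (-1)) (RtoC 1)) with (RtoC 0); [apply Cmod_0 | ].
  unfold RtoC, Cplus; simpl; f_equal; ring.
Qed.

Lemma zeta_iter_finite (lam : R) (n : nat) (z : C) :
  (forall k, (k < n)%nat -> orbit lam k z <> RtoC (-1)) ->
  zeta_iter lam n (Some z) = Some (Some (orbit lam n z)).
Proof.
  induction n as [ | n IH]; intros Hz; [reflexivity | ].
  simpl. rewrite IH by (intros; apply Hz; lia). apply zeta_step_finite, Hz. lia.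
Qed.

Lemma zeta_iter_defined (lam : R) (z : C) :
  (forall n, zeta_iter lam n (Some z) <> None) <-> (forall n, orbit lam n z <> RtoC (-1)).
Proof.
  split; intros H n.
  - induction n as [n IH] using lt_wf_ind. intros E.
    (* If [f^n z = -1], the next iterate is infinity, still defined; only the one after it is
       undefined. *)
    apply (H (S (S n))). simpl. rewrite zeta_iter_finite by exact IH.
    rewrite E, zeta_step_pole. reflexivity.
  - rewrite zeta_iter_finite by (intros; apply H). discriminate.
Qed.

Lemma zeta_iter_val_finite (lam : R) (n : nat) (z : C) :
  (forall k, orbit lam k z <> RtoC (-1)) -> zeta_iter_val lam n (Some z) = Some (orbit lam n z).
Proof.
  intros Hz. unfold zeta_iter_val. rewrite zeta_iter_finite; [reflexivity | intros; apply Hz].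
Qed.

Lemma trapped_orbit_le (lam : R) (n j : nat) (z : C) : 0 < lam < 1 ->
  Cmod (orbit lam n z) < trap_radius lam -> (n <= j)%nat ->
  Cmod (orbit lam j z) <= trap_ratio lam ^ (j - n) * trap_radius lam.
Proof.
  intros Hl Hn Hj. replace j with ((j - n) + n)%nat at 1 by lia. rewrite orbit_add.
  eapply Rle_trans; [apply orbit_trap; easy | ].
  apply Rmult_le_compat_l; [apply pow_le; destruct (trap_ratio_bounds lam Hl); lra | lra].
Qed.

Lemma trapped_orbit_small (lam : R) (n : nat) (e : R) : 0 < lam < 1 -> 0 < e ->
  exists N, forall z, Cmod (orbit lam n z) < trap_radius lam ->
    forall j, (N <= j)%nat -> Cmod (orbit lam j z) < e.
Proof.
  intros Hl He.
  destruct (trap_ratio_bounds lam Hl) as [Hm0 Hm1]. destruct (trap_radius_bounds lam Hl) as [Hd0 Hd1].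
  destruct (pow_small (trap_ratio lam) (trap_radius lam) e) as [N HN]; [lra | lra | lra | ].
  exists (N + n)%nat. intros z Hz j Hj.
  eapply Rle_lt_trans; [apply (trapped_orbit_le lam n); [easy | easy | lia] | apply HN; lia].
Qed.

Lemma in_basin_iff_basin0 (lam : R) (z : C) : 0 < lam < 1 -> (in_basin lam z <-> basin0 lam (Some z)).
Proof.
  intros Hl. destruct (trap_radius_bounds lam Hl) as [Hd0 Hd1].
  split.
  - intros [Hz [n Hn]]. split; [apply zeta_iter_defined, Hz | ].
    intros eps He. destruct (trapped_orbit_small lam n (eps / 2)) as [N HN]; [easy | lra | ].
    exists N. intros j Hj. rewrite zeta_iter_val_finite by easy.
    eapply Rle_lt_trans; [apply chord_le | ].
    replace (Cminus (orbit lam j z) (RtoC 0)) with (orbit lam j z) by ring.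
    specialize (HN z Hn j Hj). lra.
  - intros [Hz Hc]. assert (Hz' := proj1 (zeta_iter_defined lam z) Hz).
    split; [easy | ].
    destruct (chord_near_eps (RtoC 0) (trap_radius lam) Hd0) as [r [Hr Hnear]].
    destruct (Hc r Hr) as [N HN]. exists N.
    specialize (HN N (Nat.le_refl N)). rewrite zeta_iter_val_finite, chord_sym in HN by easy.
    destruct (Hnear _ HN) as [u [Eu Hu]]. injection Eu as <-.
    replace (Cminus (orbit lam N z) (RtoC 0)) with (orbit lam N z) in Hu by ring. easy.
Qed.

(** Only the first [n] iterates have to be kept off the pole by continuity; afterwards the trapping
    disc does it. *)
Lemma in_basin_open (lam : R) (z : C) (n : nat) : 0 < lam < 1 ->
  (forall k, orbit lam k z <> RtoC (-1)) -> Cmod (orbit lam n z) < trap_radius lam ->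
  exists d, 0 < d /\ forall v, Cmod (Cminus v z) < d ->
    (forall k, orbit lam k v <> RtoC (-1)) /\ Cmod (orbit lam n v) < trap_radius lam.
Proof.
  intros Hl Hz Hn.
  assert (Hfin : forall m, exists d, 0 < d /\ forall v, Cmod (Cminus v z) < d ->
     forall k, (k < m)%nat -> orbit lam k v <> RtoC (-1)).
  { induction m as [ | m [d1 [Hd1 IH]]].
    - exists 1. split; [lra | intros; lia].
    - destruct (orbit_continuity lam m z (Cmod (Cplus (orbit lam m z) (RtoC 1)))) as [d2 [Hd2 H2]].
      { intros; apply Hz. }
      { apply Cmod_gt_0, plus1_neq_0, Hz. }
      exists (Rmin d1 d2). split; [apply Rmin_pos; easy | ].
      intros v Hv k Hk E.
      destruct (Nat.eq_dec k m) as [-> | Hkm].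
      + specialize (H2 v (Rlt_le_trans _ _ _ Hv (Rmin_r _ _))). rewrite E in H2.
        replace (Cminus (RtoC (-1)) (orbit lam m z)) with (Copp (Cplus (orbit lam m z) (RtoC 1))) in H2.
        * rewrite Cmod_opp in H2. lra.
        * destruct (orbit lam m z); unfold Cminus, Cplus, Copp, RtoC; simpl; f_equal; ring.
      + apply (IH v (Rlt_le_trans _ _ _ Hv (Rmin_l _ _)) k); [lia | exact E]. }
  destruct (Hfin n) as [d1 [Hd1 H1]].
  destruct (orbit_continuity lam n z (trap_radius lam - Cmod (orbit lam n z))) as [d2 [Hd2 H2]];
    [intros; apply Hz | lra | ].
  exists (Rmin d1 d2). split; [apply Rmin_pos; easy | ].
  intros v Hv.
  assert (Hs : Cmod (orbit lam n v) < trap_radius lam).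
  { specialize (H2 v (Rlt_le_trans _ _ _ Hv (Rmin_r _ _))).
    assert (Ht := Cmod_triangle (Cminus (orbit lam n v) (orbit lam n z)) (orbit lam n z)).
    replace (Cplus (Cminus (orbit lam n v) (orbit lam n z)) (orbit lam n z)) with (orbit lam n v) in Ht by ring.
    lra. }
  split; [ | easy].
  intros k. destruct (Nat.lt_ge_cases k n) as [Hk | Hk].
  - apply (H1 v (Rlt_le_trans _ _ _ Hv (Rmin_l _ _)) k Hk).
  - apply trapped_neq_pole with lam; [easy | ].
    replace k with ((k - n) + n)%nat by lia. rewrite orbit_add. apply orbit_trap; easy.
Qed.

(** * The Fatou set coincides with the basin *)

Lemma nat_seq_dichotomy (m : nat -> nat) :
  (exists (j : nat) (phi : nat -> nat), (forall k, (phi k < phi (S k))%nat) /\ forall k, m (phi k) = j) \/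
  (forall J, exists N, forall k, (N <= k)%nat -> (J <= m k)%nat).
Proof.
  destruct (classic (exists j, forall N, exists k, (N <= k)%nat /\ m k = j)) as [[j Hj] | Hn].
  - left. exists j.
    pose (next := fun N => proj1_sig (constructive_indefinite_description _ (Hj N))).
    assert (Hnext : forall N, (N <= next N)%nat /\ m (next N) = j)
      by (intros N; exact (proj2_sig (constructive_indefinite_description _ (Hj N)))).
    pose (phi := fix phi k := match k with O => next O | S k' => next (S (phi k')) end).
    exists phi. split.
    + intros k. apply (Hnext (S (phi k))).
    + intros [ | k]; apply Hnext.
  - right. induction J as [ | J [N1 IH]]; [exists O; intros; lia | ].
    destruct (not_all_ex_not _ _ (not_ex_all_not _ _ Hn J)) as [N2 H2].
    exists (max N1 N2). intros k Hk.
    assert (m k <> J) by (intros E; apply H2; exists k; split; [lia | easy]).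
    specialize (IH k ltac:(lia)). lia.
Qed.

Lemma in_basin_Fatou (lam : R) (z : C) : 0 < lam < 1 -> in_basin lam z -> Fatou lam (Some z).
Proof.
  intros Hl [Hz [n Hn]].
  destruct (in_basin_open lam z n Hl Hz Hn) as [d [Hd Hop]].
  destruct (chord_near_eps z d Hd) as [r [Hr Hnear]].
  exists r. split; [easy | ].
  assert (HU : forall v, chord_ball (Some z) r v -> exists u, v = Some u /\
     (forall k, orbit lam k u <> RtoC (-1)) /\ Cmod (orbit lam n u) < trap_radius lam).
  { intros v Hv. destruct (Hnear v Hv) as [u [-> Hu]]. exists u. split; [easy | apply Hop, Hu]. }
  assert (Hopen : forall w, chord_ball (Some z) r w ->
     exists r', 0 < r' /\ forall v, chord w v < r' -> chord_ball (Some z) r v).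
  { intros w Hw. destruct (HU w Hw) as [u [-> _]]. apply chord_ball_open, Hw. }
  split.
  - intros k v Hv. destruct (HU v Hv) as [u [-> [Hu _]]]. apply zeta_iter_defined, Hu.
  (* The sequence [m] of exponents is arbitrary: if some value [j] recurs infinitely often, the
     limit is the [j]-th iterate; otherwise [m] tends to infinity and the limit is [0]. *)
  - intros m. destruct (nat_seq_dichotomy m) as [[j [phi [Hphi Hj]]] | Hinf].
    + exists phi, (zeta_iter_val lam j). split; [easy | ].
      intros w Hw. destruct (Hopen w Hw) as [r' [Hr' H']]. exists r'. repeat split; try easy.
      intros eps He. exists O. intros k _ v _. rewrite Hj, chord_refl. easy.
    + exists (fun k => k), (fun _ => Some (RtoC 0)). split; [intros; lia | ].
      intros w Hw. destruct (Hopen w Hw) as [r' [Hr' H']]. exists r'. repeat split; try easy.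
      intros eps He. destruct (trapped_orbit_small lam n (eps / 2)) as [J HJ]; [easy | lra | ].
      destruct (Hinf J) as [N HN]. exists N. intros k Hk v Hv.
      destruct (HU v (H' v Hv)) as [u [-> [Hu1 Hu2]]].
      rewrite zeta_iter_val_finite by easy.
      eapply Rle_lt_trans; [apply chord_le | ].
      replace (Cminus (orbit lam (m k) u) (RtoC 0)) with (orbit lam (m k) u) by ring.
      specialize (HJ u Hu2 (m k) (HN k Hk)). lra.
Qed.

Lemma strictly_increasing_ge (phi : nat -> nat) :
  (forall k, (phi k < phi (S k))%nat) -> forall k, (k <= phi k)%nat.
Proof. intros H k. induction k as [ | k IH]; [lia | specialize (H k); lia]. Qed.

Lemma Fatou_in_basin (lam : R) (z : C) : 0 < lam < 1 -> Fatou lam (Some z) -> in_basin lam z.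
Proof.
  intros Hl [r [Hr [Hdef Hnorm]]].
  destruct (trap_radius_bounds lam Hl) as [Hd0 Hd1].
  assert (Hball : forall v rho, Cmod (Cminus v z) < rho / 2 -> chord (Some z) (Some v) < rho).
  { intros v rho Hv. rewrite chord_sym. eapply Rle_lt_trans; [apply chord_le | lra]. }
  destruct (Hnorm (fun k => k)) as [phi [g [Hphi Hcvg]]].
  destruct (Hcvg (Some z)) as [r1 [Hr1 [Hsub Hunif]]].
  { unfold chord_ball. rewrite chord_refl. easy. }
  (* Below, [9 * e] bounds the iterate [phi N] at a basin point and [trap_radius lam / 2] its change
     up to [z]; the sum is below [trap_radius lam]. *)
  set (e := trap_radius lam / 40). assert (He : 0 < e) by (unfold e; lra).
  destruct (Hunif e He) as [N HN].
  assert (Hz : forall k, orbit lam k z <> RtoC (-1)).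
  { apply zeta_iter_defined. intros k. apply Hdef. unfold chord_ball. rewrite chord_refl. easy. }
  (* The index [phi N] is fixed before the basin point [a], so [a] can be taken close enough to [z]
     for this one iterate. *)
  destruct (orbit_continuity lam (phi N) z (trap_radius lam / 2)) as [d [Hd Hcont]]; [intros; apply Hz | lra | ].
  set (s := Rmin (Rmin r r1) d / 8).
  assert (Hs0 : 0 < Rmin (Rmin r r1) d) by (repeat apply Rmin_pos; easy).
  assert (Hs : 0 < s) by (unfold s; lra).
  assert (Hsr : 8 * s <= r /\ 8 * s <= r1 /\ 8 * s <= d).
  { replace (8 * s) with (Rmin (Rmin r r1) d) by (unfold s; lra).
    assert (A1 := Rmin_l (Rmin r r1) d). assert (A2 := Rmin_r (Rmin r r1) d).
    assert (A3 := Rmin_l r r1). assert (A4 := Rmin_r r r1). lra. }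
  assert (Hsq : forall v, square z s v -> Cmod (Cminus v z) <= 2 * s).
  { intros v [V1 V2]. eapply Rle_trans; [apply Cmod_le_sum | ].
    change (Rabs (fst v - fst z) + Rabs (snd v - snd z) <= 2 * s). lra. }
  destruct (basin_dense lam z s Hl Hs) as [a [Ha [Ha1 [n Ha2]]]].
  { intros v k Hv. revert k. apply zeta_iter_defined. intros k. apply Hdef.
    apply Hball. specialize (Hsq v Hv). lra. }
  assert (Haz := Hsq a Ha).
  assert (Hca : chord (Some z) (Some a) < r1) by (apply Hball; lra).
  destruct (trapped_orbit_small lam n e Hl He) as [J HJ].
  assert (Hbig := strictly_increasing_ge phi Hphi (max J N)).
  assert (Hsm : Cmod (orbit lam (phi (max J N)) a) < e) by (apply HJ; [easy | lia]).
  (* A late iterate is small at [a], so [g] is small there; comparing [g] with the iterate [phi N]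
     in [G2] carries the smallness back to the fixed index. *)
  assert (G1 := HN (max J N) ltac:(lia) (Some a) Hca).
  rewrite zeta_iter_val_finite in G1 by easy.
  assert (P1 := Cmod_ge_0 (orbit lam (phi (max J N)) a)).
  destruct (chord_near _ _ _ G1) as [u [Eu Hu]]; [unfold e in *; nra | ].
  assert (Hu5 : Cmod u <= 5 * e).
  { assert (Ht := Cmod_triangle (Cminus u (orbit lam (phi (max J N)) a)) (orbit lam (phi (max J N)) a)).
    replace (Cplus (Cminus u (orbit lam (phi (max J N)) a)) (orbit lam (phi (max J N)) a)) with u in Ht by ring.
    set (q := Cmod (orbit lam (phi (max J N)) a)) in *.
    assert (e * (1 + q) ^ 2 <= e * 4) by (apply Rmult_le_compat_l; [lra | unfold e in *; nra]).
    lra. }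
  assert (G2 := HN N (Nat.le_refl N) (Some a) Hca).
  rewrite zeta_iter_val_finite, Eu, chord_sym in G2 by easy.
  assert (P2 := Cmod_ge_0 u).
  destruct (chord_near _ _ _ G2) as [u' [Eu' Hu']]; [unfold e in *; nra | ].
  injection Eu' as <-.
  assert (Hua : Cmod (orbit lam (phi N) a) <= 9 * e).
  { assert (Ht := Cmod_triangle (Cminus (orbit lam (phi N) a) u) u).
    replace (Cplus (Cminus (orbit lam (phi N) a) u) u) with (orbit lam (phi N) a) in Ht by ring.
    assert (e * (1 + Cmod u) ^ 2 <= e * 4) by (apply Rmult_le_compat_l; [lra | unfold e in *; nra]).
    lra. }
  split; [easy | exists (phi N)].
  specialize (Hcont a ltac:(lra)).
  assert (Ht := Cmod_triangle (Copp (Cminus (orbit lam (phi N) a) (orbit lam (phi N) z))) (orbit lam (phi N) a)).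
  replace (Cplus (Copp (Cminus (orbit lam (phi N) a) (orbit lam (phi N) z))) (orbit lam (phi N) a))
    with (orbit lam (phi N) z) in Ht by ring.
  rewrite Cmod_opp in Ht. unfold e in *. lra.
Qed.

Theorem theorem5 (lam : R) (Hlam0 : 0 < lam) (Hlam1 : lam < 1) :
  forall w : Chat, Julia lam w <-> ~ basin0 lam w.
Proof.
  assert (Hl : 0 < lam < 1) by (split; easy).
  intros [z | ]; unfold Julia.
  - assert (H : Fatou lam (Some z) <-> basin0 lam (Some z)); [ | tauto].
    rewrite <- in_basin_iff_basin0 by easy. split; [apply Fatou_in_basin | apply in_basin_Fatou]; easy.
  (* Infinity belongs to neither the basin nor the Fatou set: already the first iterate is undefined
     there. *)
  - split; intros _.
    + intros [H _]. apply (H 1%nat). reflexivity.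
    + intros [r [Hr [H _]]]. apply (H 1%nat None); [ | reflexivity].
      unfold chord_ball. rewrite chord_refl. easy.
Qed.
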